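(* Let $E$ be a finite set, $\Omega=E^{\mathbb{Z}}$, and $S$ the left shift on $\Omega$. Let $\phi:\Omega\to\mathbb{R}$ be a continuous function with the extensibility property. Then every equilibrium state $\mu$ for $\phi$ is (1) Gibbs in the Dobrushin–Lanford–Ruelle sense, i.e. there is a Gibbsian specification $\gamma$ on $\Omega$ such that $\mu$ is a Gibbs measure for $\gamma$; (2) weak Bowen–Gibbs relative to the potential $\phi$, i.e. there exist a constant $P$ and a sequence $(C_n)_{n\ge1}$ of positive reals with $\lim_{n\to\infty}\frac1n\log C_n=0$ such that for all $n\in\mathbb{N}$ and all $\omega\in\Omega$, $$\frac{1}{C_n}\le \frac{\mu(\{\tilde\omega\in\Omega:\tilde\omega_0^{n-1}=\omega_0^{n-1}\})}{\exp\big(S_n\phi(\omega)-nP\big)}\le C_n,\qquad S_n\phi=\sum_{k=0}^{n-1}\phi\circ S^k.$$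
   Context: $E$ is finite with the discrete topology, $\Omega=E^{\mathbb{Z}}$ carries the product topology, and $S:\Omega\to\Omega$ is the left shift $(S\omega)_i=\omega_{i+1}$. For $\omega\in\Omega$ and $a\in E$, $\omega^a$ denotes the configuration equal to $a$ at site $0$ and to $\omega_k$ at every site $k\neq0$. A continuous $\phi:\Omega\to\mathbb{R}$ has the extensibility property if for all $a,\tilde a\in E$ the functions $\rho_n^{a,\tilde a}(\omega)=\sum_{i=-n}^{n}\big[\phi(S^i\omega^{a})-\phi(S^i\omega^{\tilde a})\big]$ converge uniformly in $\omega\in\Omega$ as $n\to\infty$. A shift-invariant Borel probability measure $\mu$ is an equilibrium state for $\phi$ if $h(\mu)+\int\phi\,d\mu=P(\phi)$, where $h(\mu)$ is the measure-theoretic (Kolmogorov–Sinai) entropy and $P(\phi)$ the topological pressure. For finite $\Lambda\subset\mathbb{Z}$ and $\xi,\omega\in\Omega$, $\xi_\Lambda\omega_{\Lambda^c}$ denotes the configuration equal to $\xi$ on $\Lambda$ and to $\omega$ off $\Lambda$. A specification is a family $\gamma=(\gamma_\Lambda)_{\Lambda\subset\mathbb{Z}\text{ finite}}$ where, for each $\omega$, $\gamma_\Lambda(\cdot|\omega_{\Lambda^c})$ is a probability on $E^\Lambda$ depending only on $\omega_{\Lambda^c}$; writing $\gamma_\Lambda(f|\omega)=\sum_{\xi_\Lambda\in E^\Lambda}\gamma_\Lambda(\xi_\Lambda|\omega_{\Lambda^c})f(\xi_\Lambda\omega_{\Lambda^c})$, it is required to be consistent: for finite $\Delta\subset\Lambda$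 and bounded measurable $f$, $\sum_{\xi_\Lambda}\gamma_\Lambda(\xi_\Lambda|\omega_{\Lambda^c})\gamma_\Delta(f|\xi_\Lambda\omega_{\Lambda^c})=\gamma_\Lambda(f|\omega)$. It is Gibbsian if it is non-null ($\inf_\omega\gamma_\Lambda(\omega_\Lambda|\omega_{\Lambda^c})>0$ for all finite $\Lambda$) and continuous/quasi-local ($\omega\mapsto\gamma_\Lambda(\omega_\Lambda|\omega_{\Lambda^c})$ is continuous for all finite $\Lambda$). A probability measure $\mu$ is Gibbs for $\gamma$ if $\int\gamma_\Lambda(f|\omega)\,\mu(d\omega)=\int f\,d\mu$ for all $f\in C(\Omega)$ and finite $\Lambda$. *)

(* Defs.v *)
From HB Require Import structures.
From mathcomp Require Import all_boot all_order all_algebra finmap.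
From mathcomp Require Import all_classical all_reals all_analysis.
Import Order.TTheory GRing.Theory Num.Theory.
Import numFieldTopology.Exports numFieldNormedType.Exports.
Set Implicit Arguments.
Unset Strict Implicit.
Unset Printing Implicit Defensive.
Local Open Scope classical_set_scope.
Local Open Scope ring_scope.

(* The alphabet.  E : finType, together with a point e0 : E (needed   *)
(* because mathcomp-analysis' topological/measurable types are        *)
(* pointed; if E were empty there would be no probability measure on  *)
(* Omega and the theorem would be vacuous).                           *)
Definition Epd (E : finType) (e0 : E) : Type := E.
HB.instance Definition _ (E : finType) (e0 : E) := Choice.copy (@Epd E e0) E.
HB.instance Definition _ (E : finType) (e0 : E) := isPointed.Build (@Epd E e0) e0.

Definition Omega (E : finType) (e0 : E) : Type :=
  prod_topology (fun _ : int => discrete_topology (@Epd E e0)).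

Definition OmegaM (E : finType) (e0 : E) := g_sigma_algebraType (@open (Omega e0)).

Definition shift (E : finType) (e0 : E) (w : Omega e0) : Omega e0 :=
  fun k => w (k + 1).
Definition shift_inv (E : finType) (e0 : E) (w : Omega e0) : Omega e0 :=
  fun k => w (k - 1).
Definition shift_pow (E : finType) (e0 : E) (i : int) : Omega e0 -> Omega e0 :=
  match i with
  | Posz n => iter n (@shift E e0)
  | Negz n => iter n.+1 (@shift_inv E e0)
  end.

Definition set0at (E : finType) (e0 : E) (w : Omega e0) (a : E) : Omega e0 :=
  fun k => if k == 0 then (a : Epd e0) else w k.

Definition birkhoff (E : finType) (e0 : E) (R : realType) (phi : Omega e0 -> R)
  (n : nat) (w : Omega e0) : R :=
  \sum_(0 <= k < n) phi (iter k (@shift E e0) w).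

Definition rho_n (E : finType) (e0 : E) (R : realType) (phi : Omega e0 -> R)
  (a a' : E) (n : nat) (w : Omega e0) : R :=
  \sum_(0 <= j < (2 * n).+1)
     (phi (shift_pow (j%:Z - n%:Z) (set0at w a))
      - phi (shift_pow (j%:Z - n%:Z) (set0at w a'))).

Definition extensible (E : finType) (e0 : E) (R : realType) (phi : Omega e0 -> R) : Prop :=
  forall a a' : E, exists rho : Omega e0 -> R,
    forall eps : R, 0 < eps -> exists N : nat, forall n : nat, (N <= n)%N ->
      forall w : Omega e0, `|rho_n phi a a' n w - rho w| < eps.

Definition shift_invariant (E : finType) (e0 : E) (R : realType)
  (mu : probability (OmegaM e0) R) : Prop :=
  forall A : set (OmegaM e0), measurable A ->
    mu ((@shift E e0) @^-1` A) = mu A.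

Definition is_partition (E : finType) (e0 : E) (P : seq (set (OmegaM e0))) : Prop :=
  (forall i, (i < size P)%N -> measurable (nth set0 P i)) /\
  (forall i j, (i < size P)%N -> (j < size P)%N -> i != j ->
     nth set0 P i `&` nth set0 P j = set0) /\
  (forall x : OmegaM e0, exists2 i, (i < size P)%N & nth set0 P i x).

Definition eta_fn (R : realType) (x : R) : R := if x == 0 then 0 else - (x * ln x).

Definition join_entropy (E : finType) (e0 : E) (R : realType)
  (mu : probability (OmegaM e0) R) (P : seq (set (OmegaM e0))) (n : nat) : R :=
  \sum_(c : {ffun 'I_n -> 'I_(size P)})
     eta_fn (fine (mu [set x : OmegaM e0 |
                      forall k : 'I_n, nth set0 P (c k) (iter k (@shift E e0) x)])).

Definition entropy_part (E : finType) (e0 : E) (R : realType)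
  (mu : probability (OmegaM e0) R) (P : seq (set (OmegaM e0))) : R :=
  limn (fun n : nat => join_entropy mu P n / n%:R).

Definition KS_entropy (E : finType) (e0 : E) (R : realType)
  (mu : probability (OmegaM e0) R) : \bar R :=
  ereal_sup [set (entropy_part mu P)%:E | P in [set P | is_partition P]].

(* The standard metric d(w,w') = 2^{-min{|k| : w_k <> w'_k}} on Omega. *)
Definition omega_dist (E : finType) (e0 : E) (R : realType) (w w' : Omega e0) : R :=
  sup [set r : R | r = 0 \/ exists k : int, w k != w' k /\ r = (2%:R ^- absz k)].

Definition dist_n (E : finType) (e0 : E) (R : realType) (n : nat) (w w' : Omega e0) : R :=
  \big[Num.max/0]_(k < n) omega_dist R (iter k (@shift E e0) w) (iter k (@shift E e0) w').

Definition separated (E : finType) (e0 : E) (R : realType) (n : nat) (eps : R)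
  (F : seq (Omega e0)) : Prop :=
  forall i j, (i < size F)%N -> (j < size F)%N -> i != j ->
    eps < dist_n R n (nth point F i) (nth point F j).

Definition Zn (E : finType) (e0 : E) (R : realType) (phi : Omega e0 -> R)
  (n : nat) (eps : R) : R :=
  sup [set s : R | exists F : seq (Omega e0),
         separated n eps F /\ s = \sum_(x <- F) expR (birkhoff phi n x)].

Definition pressure_eps (E : finType) (e0 : E) (R : realType) (phi : Omega e0 -> R)
  (eps : R) : \bar R :=
  limn_esup (fun n : nat => (ln (Zn phi n eps) / n%:R)%:E).

Definition pressure (E : finType) (e0 : E) (R : realType) (phi : Omega e0 -> R) : \bar R :=
  lim (pressure_eps phi eps @[eps --> 0^'+]).

Definition equilibrium_state (E : finType) (e0 : E) (R : realType)
  (phi : Omega e0 -> R) (mu : probability (OmegaM e0) R) : Prop :=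
  shift_invariant mu /\
  (KS_entropy mu + \int[mu]_x (phi x)%:E = pressure phi)%E.

Definition glue (E : finType) (e0 : E) (L : {fset int}) (xi : {ffun L -> E})
  (w : Omega e0) : Omega e0 :=
  fun k => match (insub k : option L) with
           | Some s => (xi s : Epd e0)
           | None => w k
           end.

Definition restr (E : finType) (e0 : E) (L : {fset int}) (w : Omega e0) : {ffun L -> E} :=
  [ffun s : L => (w (val s) : E)].

(* A candidate specification: gamma L xi w = gamma_Lambda(xi_Lambda | w_{Lambda^c}). *)
Definition spec_type (E : finType) (e0 : E) (R : realType) : Type :=
  forall L : {fset int}, {ffun L -> E} -> Omega e0 -> R.

Definition spec_apply (E : finType) (e0 : E) (R : realType) (gamma : spec_type e0 R)
  (L : {fset int}) (f : Omega e0 -> R) (w : Omega e0) : R :=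
  \sum_(xi : {ffun L -> E}) gamma L xi w * f (glue xi w).

Definition is_specification (E : finType) (e0 : E) (R : realType) (gamma : spec_type e0 R) : Prop :=
  (forall (L : {fset int}) (xi : {ffun L -> E}) (w w' : Omega e0),
      (forall k, k \notin L -> w k = w' k) -> gamma L xi w = gamma L xi w') /\
  (forall (L : {fset int}) (xi : {ffun L -> E}) (w : Omega e0), 0 <= gamma L xi w) /\
  (forall (L : {fset int}) (w : Omega e0), \sum_(xi : {ffun L -> E}) gamma L xi w = 1) /\
  (forall (L D : {fset int}), (D `<=` L)%fset ->
     forall f : OmegaM e0 -> R, measurable_fun setT f ->
     (exists M : R, forall x, `|f x| <= M) ->
     forall w : Omega e0,
       \sum_(xi : {ffun L -> E}) gamma L xi w * spec_apply gamma D f (glue xi w)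
       = spec_apply gamma L f w).

Definition gibbsian_spec (E : finType) (e0 : E) (R : realType) (gamma : spec_type e0 R) : Prop :=
  is_specification gamma /\
  (forall L : {fset int}, exists2 c : R, 0 < c &
      forall w : Omega e0, c <= gamma L (restr L w) w) /\
  (forall L : {fset int}, continuous (fun w : Omega e0 => gamma L (restr L w) w)).

Definition is_gibbs_for (E : finType) (e0 : E) (R : realType)
  (mu : probability (OmegaM e0) R) (gamma : spec_type e0 R) : Prop :=
  forall f : Omega e0 -> R, continuous f -> forall L : {fset int},
    (\int[mu]_x (spec_apply gamma L f x)%:E = \int[mu]_x (f x)%:E)%E.

Definition cyl (E : finType) (e0 : E) (n : nat) (w : Omega e0) : set (OmegaM e0) :=
  [set w' : OmegaM e0 | forall k : nat, (k < n)%N -> w' k%:Z = w k%:Z].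

Definition weak_bowen_gibbs (E : finType) (e0 : E) (R : realType)
  (mu : probability (OmegaM e0) R) (phi : Omega e0 -> R) : Prop :=
  exists (P : R) (C : nat -> R),
    (forall n : nat, (0 < n)%N -> 0 < C n) /\
    ((fun n : nat => ln (C n) / n%:R) @ \oo --> (0 : R)) /\
    (forall (n : nat) (w : Omega e0), (0 < n)%N ->
       (C n)^-1 <= fine (mu (cyl n w)) / expR (birkhoff phi n w - n%:R * P) <= C n).

(* Main.v *)
Require Import Defs.
From HB Require Import structures.
From mathcomp Require Import all_boot all_order all_algebra finmap.
From mathcomp Require Import all_classical all_reals all_analysis measurable_realfun.
From mathcomp Require Import ring lra zify.
Import Order.TTheory GRing.Theory Num.Theory.
Import numFieldTopology.Exports numFieldNormedType.Exports.
Set Implicit Arguments.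
Unset Strict Implicit.
Unset Printing Implicit Defensive.
Local Open Scope classical_set_scope.
Local Open Scope ring_scope.

(* Extensibility makes [Delta x y = lim_n sum_(|i| <= n) (phi (S^i x) - phi (S^i y))] *)
(* converge for configurations that differ at finitely many sites, and the specification *)
(* is the one with relative weights [exp Delta].  Telescoping over sites, with symmetric *)
(* windows, shows that [Delta x y] is the difference of the Birkhoff sums over [0, n) up *)
(* to o(n) when [x] and [y] differ on [0, n) only.  If a centered function [u - gamma u] *)
(* had nonzero mean under the equilibrium state, multiplying the finite-volume Gibbs     *)
(* weights by factors [1 + t (u - gamma u)] in disjoint windows would not change the     *)
(* partition function but would raise the energy linearly, so the Gibbs inequality       *)
(* would bound the entropy strictly below [P - int phi].  This uses that the             *)
(* Kolmogorov-Sinai entropy is at most the entropy rate of the cylinders.  The weak      *)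
(* Bowen-Gibbs bounds are then read off the DLR equation for the box [0, n).             *)

(* mathcomp-analysis also defines a [glue]. *)
Local Notation glue := Defs.glue.

(** Extensibility controls changes at site $0$ only. Shifting the summation window alters [dsum] by
    two far-away differences of values of [phi], which tend to $0$, so changes at any finite set of
    sites are controlled as well, uniformly in the configurations ([ucauchy_seq]). The limit [Delta]
    is additive along finite changes, shift-invariant and uniformly continuous. Additivity makes the
    normalised weights $e^{\Delta}$ a consistent family, because moving the reference configuration
    multiplies all weights by one factor ([gibbs_specE], [gibbs_spec_consistent]).

    The link with thermodynamics is [Delta_birkhoff]: the weights $e^{\Delta}$ and $e^{S_n\phi}$ on
    a block of length $n$ differ by factors $e^{o(n)}$. With [birkhoff_variation], partition
    functions may thus be computed with either weight and any boundary condition, and their growth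
    rate is at most the pressure ([ln_Zfix_le]).

    The DLR equations come from rigidity in the variational principle. On a block, entropy plus mean
    energy is at most the log partition function ([ent_variational]). For an equilibrium state both
    sides are $nP+o(n)$, the left one thanks to [KS_entropy_le_block]. Hence no local perturbation
    can gain linearly: [Ex_ln_le] bounds the mean of $\ln g$ by $\ln(1+d)$ whenever the conditional
    means of $g$ are at most $1+d$. For $g=1+tu$ with $u$ nearly centered under the kernel, the
    first order in $t$ forces $\int u\,d\mu\le0$ ([Ex_centered_le0]); taking $u=\pm(f-\gamma f)$
    yields [Ex_spec_apply].

    The DLR equation then writes $\mu$ of a cylinder as an average of kernel values, each equal to
    $e^{S_n\phi(\omega)-nP+o(n)}$ uniformly in the boundary condition ([gibbs_spec_cyl]), which
    gives the weak Bowen-Gibbs bounds. *)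

(** * Topology of the full shift, expressed through central windows *)

Section Configurations.
Context {E : finType} {e0 : E}.
Implicit Types x y z w : Omega e0.

(** The sets [agree N x] form a countable base of neighbourhoods of [x]; all later topology is
    reduced to them. *)
Definition agree (N : nat) x y := forall k : int, (`|k| <= N)%N -> x k = y k.

Lemma agree_refl N x : agree N x x. Proof. by []. Qed.

Lemma agree_sym N x y : agree N x y -> agree N y x.
Proof. by move=> h k /h. Qed.

Lemma agree_trans N x y z : agree N x y -> agree N y z -> agree N x z.
Proof. by move=> h h' k kN; rewrite h ?h'. Qed.

Lemma agree_le N M x y : (N <= M)%N -> agree M x y -> agree N x y.
Proof. by move=> NM h k kN; apply: h; apply: leq_trans NM. Qed.

Lemma coord_open (k : int) (a : E) : open [set x : Omega e0 | x k = a].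
Proof.
have pc := @proj_continuous int (fun _ => discrete_topology (@Epd E e0)) k.
have h := open_comp (fun y _ => pc y) (discrete_open [set (a : discrete_topology (Epd e0))]).
exact: h.
Qed.

Lemma agree_open N x : open (agree N x).
Proof.
have -> : agree N x = \bigcap_(k in [set k : int | (`|k| <= N)%N]) [set y | y k = x k].
  apply/seteqP; split => y h k.
    by move=> kN /=; rewrite h.
  by move=> kN; rewrite (h k kN).
rewrite bigcap_fset_set; last first.
  pose s := [seq Posz i | i <- iota 0 N.+1] ++ [seq - Posz i | i <- iota 0 N.+1].
  apply: (@sub_finite_set _ _ [set` s]) => // k /= kN.
  rewrite mem_cat; case: k kN => n kN.
    by rewrite (map_f Posz) // mem_iota /= add0n.
  by rewrite NegzE (map_f (fun i => - Posz i)) ?orbT // mem_iota /= add0n.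
elim/big_ind: _ => [|A B oA oB|k _]; [exact: openT|exact: openI|exact: coord_open].
Qed.

Lemma nbhs_agree N x : nbhs x (agree N x).
Proof. by apply: open_nbhs_nbhs; split; [exact: agree_open|]. Qed.

(** The product topology is a supremum of topologies pulled back from the coordinates, so
    convergence of the filter generated by the windows around [x] is checked one coordinate at a
    time, and coordinate [k] is already fixed by the window of radius $|k|$. *)
Lemma nbhs_agreeP x (U : set (Omega e0)) :
  nbhs x U -> exists N, agree N x `<=` U.
Proof.
pose F : set_system (Omega e0) := [set V | exists N, agree N x `<=` V].
have FF : Filter F.
  split.
  - by exists 0%N.
  - move=> P Q [N NP] [M MQ]; exists (maxn N M) => y h; split.
      by apply: NP; apply: agree_le h; rewrite leq_maxl.
    by apply: MQ; apply: agree_le h; rewrite leq_maxr.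
  - by move=> P Q PQ [N NP]; exists N => y /NP /PQ.
move: U; change (F --> x).
apply/(@cvg_sup _ _ _ F x FF) => k.
move=> U [] V [[B oB] BV] Vx VU.
exists `|k|%N => y h; apply: VU; rewrite -BV /=.
by rewrite -BV /= in Vx; rewrite -(h k).
Qed.

Lemma Omega_compact : compact [set: Omega e0].
Proof.
have := @tychonoff int (fun _ => discrete_topology (@Epd E e0)) (fun _ => setT).
have -> : [set f : forall i : int, discrete_topology (Epd e0) | forall i, setT (f i)]
   = [set: Omega e0] by apply/seteqP; split.
apply => _; apply: finite_compact.
by apply: (@sub_finite_set _ _ [set` (enum E : seq (discrete_topology (Epd e0)))]) => // a _ /=; exact: mem_enum.
Qed.

(** By compactness this is the same as continuity; the uniform window size is what estimates on sums
    over many shifts require. *)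
Definition ucont {R : realType} (f : Omega e0 -> R) :=
  forall eps : R, 0 < eps -> exists N, forall x y, agree N x y -> `|f x - f y| <= eps.

Lemma continuous_ucont {R : realType} (f : Omega e0 -> R) :
  continuous f -> ucont f.
Proof.
move=> fc eps eps0.
have /compact_near_coveringP cov := Omega_compact.
have /= H : \forall N \near \oo, [set: Omega e0] `<=`
   (fun x => forall y, agree N x y -> `|f x - f y| <= eps).
  apply: cov => x _.
  have eps20 : 0 < eps / 2 by rewrite divr_gt0.
  have /cvgrPdist_lt /(_ _ eps20) /nbhs_agreeP [N hN] := fc x.
  exists (agree N x, [set M | (N <= M)%N]).
    by split; [exact: nbhs_agree|exists N].
  move=> [y M] [/= hy NM] z yz.
  have h1 := hN _ hy; have h2 := hN _ (agree_trans hy (agree_le NM yz)).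
  move: h1 h2 => /=; rewrite !ltr_norml ler_norml.
  by move=> /andP[? ?] /andP[? ?]; apply/andP; split; lra.
by case: H => N _ /(_ N (leqnn _)) H; exists N => x y; exact: H.
Qed.

Lemma ucont_continuous {R : realType} (f : Omega e0 -> R) :
  ucont f -> continuous f.
Proof.
move=> fu x U /= /nbhs_ballP [eps /= eps0 hU].
have eps20 : 0 < eps / 2 by rewrite divr_gt0.
have [N hN] := fu _ eps20.
apply: filterS (nbhs_agree N x) => y /hN h.
by apply: hU => /=; rewrite /ball /= (le_lt_trans h) // gtr_pMr // invf_lt1 // ltr1n.
Qed.

Lemma ucont_bounded {R : realType} (f : Omega e0 -> R) :
  ucont f -> exists2 B : R, 0 < B & forall x, `|f x| <= B.
Proof.
move=> fu.
have /compact_near_coveringP cov := Omega_compact.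
have /= H : \forall N \near \oo, [set: Omega e0] `<=` (fun x => `|f x| <= N%:R :> R).
  apply: cov => x _.
  have [N hN] := fu 1 ltr01.
  have [K hK] : exists K : nat, `|f x| + 1 <= K%:R.
    exists (Num.trunc (`|f x| + 1)).+1; apply: ltW; exact: truncnS_gt.
  exists (agree N x, [set M | (K <= M)%N]).
    by split; [exact: nbhs_agree|exists K].
  move=> [y M] [/= /hN hy KM].
  have KMR : K%:R <= M%:R :> R by rewrite ler_nat.
  have : `|f y| <= `|f x| + `|f x - f y|.
    by rewrite -{1}[f y](subKr (f x)) (le_trans (ler_normB _ _)).
  lra.
case: H => N _ /(_ N (leqnn _)) H; exists (N%:R + 1) => [|x].
  by rewrite ltr_wpDl.
by rewrite (le_trans (H x I)) // lerDl.
Qed.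

End Configurations.

(** * Shifts by integers, finite changes, and closure properties of uniform continuity *)

Section Shifts.
Context {E : finType} {e0 : E}.
Implicit Types x y z w : Omega e0.

Definition sh (k : int) x : Omega e0 := fun i => x (i + k).

Lemma sh0 x : sh 0 x = x.
Proof. by apply/funext => i; rewrite /sh addr0. Qed.

Lemma sh_sh (k l : int) x : sh k (sh l x) = sh (k + l) x.
Proof. by apply/funext => i; rewrite /sh addrA. Qed.

Lemma iter_shiftE (n : nat) x : iter n (@Defs.shift E e0) x = sh n x.
Proof.
elim: n => [|n IH]; first by rewrite /= sh0.
by rewrite iterS IH; apply/funext => i; rewrite /Defs.shift /sh; congr (x _); lia.
Qed.

Lemma shift_powE (k : int) x : shift_pow k x = sh k x.
Proof.
case: k => n; first exact: iter_shiftE.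
rewrite NegzE -[LHS]/(iter n.+1 (@shift_inv E e0) x).
elim: n.+1 => [|m IH]; first by rewrite /= oppr0 sh0.
by rewrite iterS IH; apply/funext => i; rewrite /shift_inv /sh; congr (x _); lia.
Qed.

Lemma agree_sh (k : int) N x y : agree (N + `|k|) x y -> agree N (sh k x) (sh k y).
Proof. by move=> h i iN; apply: h; lia. Qed.

Definition eqoff (s : seq int) x y := forall k, k \notin s -> x k = y k.

Lemma eqoff_refl P x : eqoff P x x. Proof. by []. Qed.

Lemma eqoff_sym P x y : eqoff P x y -> eqoff P y x.
Proof. by move=> h k /h. Qed.

Lemma eqoff_trans P x y z : eqoff P x y -> eqoff P y z -> eqoff P x z.
Proof. by move=> h h' k kP; rewrite h ?h'. Qed.

Lemma eqoff_sub (s t : seq int) x y : {subset s <= t} -> eqoff s x y -> eqoff t x y.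
Proof. by move=> st h k kt; apply: h; apply: contra kt; exact: st. Qed.

Lemma eq_ucont {R : realType} (f g : Omega e0 -> R) : f =1 g -> ucont f -> ucont g.
Proof. by move=> /funext ->. Qed.

Lemma ucont_cst {R : realType} (c : R) : ucont (fun _ : Omega e0 => c).
Proof. by move=> eps eps0; exists 0%N => x y _; rewrite subrr normr0 ltW. Qed.

Lemma ucont_lift {R : realType} (f : Omega e0 -> R) (F : Omega e0 -> Omega e0) M :
  (forall N x y, agree (N + M) x y -> agree N (F x) (F y)) ->
  ucont f -> ucont (f \o F).
Proof.
move=> hF fu eps eps0; have [N hN] := fu _ eps0; exists (N + M)%N => x y h.
by apply: hN; apply: hF.
Qed.

Lemma ucont_sh {R : realType} (f : Omega e0 -> R) k : ucont f -> ucont (f \o sh k).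
Proof. by apply: (@ucont_lift _ _ _ `|k|%N) => N x y; exact: agree_sh. Qed.

Lemma ucontD {R : realType} (f g : Omega e0 -> R) :
  ucont f -> ucont g -> ucont (fun x => f x + g x).
Proof.
move=> fu gu eps eps0; have eps20 : 0 < eps / 2 by rewrite divr_gt0.
have [N hN] := fu _ eps20; have [M hM] := gu _ eps20.
exists (maxn N M) => x y h.
have := hN x y (agree_le (leq_maxl _ _) h).
have := hM x y (agree_le (leq_maxr _ _) h).
rewrite !ler_norml => /andP[? ?] /andP[? ?]; apply/andP; split; lra.
Qed.

Lemma ucontM {R : realType} (f g : Omega e0 -> R) :
  ucont f -> ucont g -> ucont (fun x => f x * g x).
Proof.
move=> fu gu eps eps0.
have [B B0 hB] := ucont_bounded fu; have [C C0 hC] := ucont_bounded gu.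
have e1 : 0 < eps / 2 / C by rewrite !divr_gt0.
have e2 : 0 < eps / 2 / B by rewrite !divr_gt0.
have [N hN] := fu _ e1; have [M hM] := gu _ e2.
exists (maxn N M) => x y h.
have h1 := hN x y (agree_le (leq_maxl _ _) h).
have h2 := hM x y (agree_le (leq_maxr _ _) h).
have -> : f x * g x - f y * g y = (f x - f y) * g x + f y * (g x - g y) by ring.
rewrite (le_trans (ler_normD _ _)) // !normrM.
have : `|f x - f y| * `|g x| <= eps / 2 / C * C by rewrite ler_pM.
have : `|f y| * `|g x - g y| <= B * (eps / 2 / B) by rewrite ler_pM.
by rewrite divfK ?gt_eqF // [B * _]mulrC divfK ?gt_eqF //; lra.
Qed.

Lemma ucont_sum {R : realType} (I : Type) (s : seq I) (P : pred I)
    (f : I -> Omega e0 -> R) :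
  (forall i, P i -> ucont (f i)) -> ucont (fun x => \sum_(i <- s | P i) f i x).
Proof.
move=> fu; elim: s => [|i s IH].
  by apply: (eq_ucont _ (ucont_cst 0)) => x; rewrite big_nil.
case: (boolP (P i)) => Pi.
  by apply: (eq_ucont _ (ucontD (fu i Pi) IH)) => x; rewrite big_cons Pi.
by apply: (eq_ucont _ IH) => x; rewrite big_cons (negbTE Pi).
Qed.

Lemma ucont_comp {R : realType} (h : R -> R) (f : Omega e0 -> R) :
  (forall x, {for f x, continuous h}) -> ucont f -> ucont (h \o f).
Proof.
move=> hc /ucont_continuous fc; apply: continuous_ucont => x.
by apply: continuous_comp; [exact: fc|exact: hc].
Qed.

Lemma ucont_unif {R : realType} (f : Omega e0 -> R) :
  (forall eps : R, 0 < eps -> exists2 g, ucont g & forall x, `|g x - f x| <= eps) ->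
  ucont f.
Proof.
move=> h eps eps0; have e3 : 0 < eps / 3 by rewrite divr_gt0.
have [g /(_ _ e3) [N hN] gf] := h _ e3.
exists N => x y /hN; move: (gf x) (gf y).
by rewrite !ler_norml => /andP[? ?] /andP[? ?] /andP[? ?]; apply/andP; split; lra.
Qed.

End Shifts.

(** * Elementary uniform estimates *)

Lemma fin_uniform_bound (T : finType) (Q : T -> nat -> Prop) :
  (forall t, exists N, forall n, (N <= n)%N -> Q t n) ->
  exists N, forall t n, (N <= n)%N -> Q t n.
Proof.
move=> /choice [f hf]; exists (\max_t f t) => t n h.
by apply: hf; apply: leq_trans h; exact: leq_bigmax.
Qed.

(** Meant for sums over a block in which only the [N] terms near one end are large; when the large
    terms sit at the other end, the sum is reversed first. *)
Lemma norm_sum_small (R : realType) (a : nat -> R) (n N : nat) (eps B : R) :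
  0 <= eps -> 0 <= B ->
  (forall k, (k < n)%N -> (N <= k)%N -> `|a k| <= eps) ->
  (forall k, (k < n)%N -> `|a k| <= B) ->
  `|\sum_(0 <= k < n) a k| <= n%:R * eps + N%:R * B.
Proof.
move=> eps0 B0 h1 h2.
suff: `|\sum_(0 <= k < n) a k| <= n%:R * eps + (minn n N)%:R * B.
  by move/le_trans; apply; rewrite lerD2l ler_wpM2r // ler_nat geq_minr.
elim: n h1 h2 => [|n IH] h1 h2.
  by rewrite big_geq // normr0 mul0r add0r mulr_ge0.
rewrite big_nat_recr //= (le_trans (ler_normD _ _)) //.
have {}IH := IH (fun k kn => h1 k (ltnW kn)) (fun k kn => h2 k (ltnW kn)).
case: (leqP N n) => nN.
  have := h1 n (ltnSn _) nN; rewrite (minn_idPr nN) in IH.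
  rewrite (minn_idPr (leqW nN)) -(natr1 n) mulrDl mul1r; lra.
have := h2 n (ltnSn _); rewrite (minn_idPl (ltnW nN)) in IH.
rewrite (minn_idPl nN) -!(natr1 n) !mulrDl !mul1r; lra.
Qed.

Lemma eventually_le_linear (R : realType) (C eps : R) : 0 < eps ->
  exists N, forall n, (N <= n)%N -> C <= n%:R * eps.
Proof.
move=> eps0; exists (Num.trunc (C / eps)).+1 => n h.
rewrite -ler_pdivrMr // ltW // (lt_le_trans (truncnS_gt _)) // ler_nat.
exact: h.
Qed.

(** * The energy cocycle [Delta] of an extensible potential *)

Section Cocycle.
Context {E : finType} {e0 : E} {R : realType}.
Variable phi : Omega e0 -> R.
Hypotheses (phiu : ucont phi) (phie : extensible phi).
Implicit Types x y z w : Omega e0.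

Definition dsum (n : nat) x y : R :=
  \sum_(0 <= j < (2 * n).+1) (phi (sh (j%:Z - n%:Z) x) - phi (sh (j%:Z - n%:Z) y)).

Lemma dsumD n x y z : dsum n x y + dsum n y z = dsum n x z.
Proof. by rewrite /dsum -big_split /=; apply: eq_bigr => j _; rewrite addrA subrK. Qed.

Lemma dsumxx n x : dsum n x x = 0.
Proof. by rewrite /dsum big1 // => j _; rewrite subrr. Qed.

(** The window gains a term at one end and loses one at the other; by [phi_far] both corrections
    vanish in the limit. *)
Lemma dsum_sh1 n x y : dsum n (sh 1 x) (sh 1 y) =
  dsum n x y + (phi (sh n.+1%:Z x) - phi (sh n.+1%:Z y))
             - (phi (sh (- n%:Z) x) - phi (sh (- n%:Z) y)).
Proof.
pose T (i : int) := phi (sh i x) - phi (sh i y).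
have -> : dsum n (sh 1 x) (sh 1 y) = \sum_(0 <= j < (2 * n).+1) T (j.+1%:Z - n%:Z).
  rewrite /dsum; apply: eq_bigr => j _; rewrite !sh_sh /T.
  by have -> : j%:Z - n%:Z + 1 = j.+1%:Z - n%:Z by lia.
have -> : dsum n x y = \sum_(0 <= j < (2 * n).+1) T (j%:Z - n%:Z) by [].
have : \sum_(0 <= j < (2 * n).+2) T (j%:Z - n%:Z)
     = T (0%:Z - n%:Z) + \sum_(0 <= j < (2 * n).+1) T (j.+1%:Z - n%:Z).
  by rewrite big_nat_recl.
rewrite big_nat_recr //= sub0r => h.
have -> : \sum_(0 <= j < (2 * n).+1) T (j.+1%:Z - n%:Z)
   = \sum_(0 <= j < (2 * n).+1) T (j%:Z - n%:Z) + T ((2 * n).+1%:Z - n%:Z) - T (- n%:Z).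
  by rewrite h addrAC subrr add0r.
by rewrite /T; have -> : (2 * n).+1%:Z - n%:Z = n.+1%:Z by lia.
Qed.

Lemma seq_int_bounded (s : seq int) : exists K : nat, forall k, k \in s -> (`|k| <= K)%N.
Proof.
exists (\max_(k <- s) `|k|%N) => k ks.
by rewrite (big_rem k) //= leq_maxl.
Qed.

(** After a large shift the sites of [s] lie outside the window that determines [phi] up to
    [eps]. *)
Lemma phi_far (s : seq int) (eps : R) : 0 < eps -> exists N : nat,
  forall (i : int) x y, (N <= `|i|)%N -> eqoff s x y ->
    `|phi (sh i x) - phi (sh i y)| <= eps.
Proof.
move=> /phiu [N hN]; have [K hK] := seq_int_bounded s.
exists (N + K).+1 => i x y iN h; apply: hN => k kN; apply: h.
by apply/negP => /hK; lia.
Qed.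

(** Uniformity over all pairs is kept because it is what later makes [Delta] bounded and
    continuous. *)
Definition ucauchy (P : seq int) := forall eps : R, 0 < eps -> exists N : nat,
  forall n m, (N <= n)%N -> (N <= m)%N -> forall x y, eqoff P x y ->
    `|dsum n x y - dsum m x y| <= eps.

Lemma ucauchy0 : ucauchy [:: 0].
Proof.
move=> eps eps0; have e2 : 0 < eps / 2 by rewrite divr_gt0.
have [|N hN] := @fin_uniform_bound (E * E)%type (fun p n =>
    forall m w, (n <= m)%N -> `|rho_n phi p.1 p.2 n w - rho_n phi p.1 p.2 m w| <= eps).
  move=> [a a']; have [rho hr] := phie a a'; have [N hN] := hr _ e2.
  exists N => n Nn m w nm.
  have h1 := hN _ Nn w; have h2 := hN _ (leq_trans Nn nm) w.
  move: h1 h2 => /=; rewrite !ltr_norml ler_norml => /andP[? ?] /andP[? ?].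
  by apply/andP; split; lra.
(* Setting site $0$ of [x] to [x 0] returns [x], and setting it to [y 0] returns [y]. *)
have rhoE n x y : eqoff [:: 0] x y -> dsum n x y = rho_n phi (x 0) (y 0) n x.
  move=> h; apply: eq_bigr => j _; rewrite !shift_powE; congr (phi (sh _ _) - phi (sh _ _)).
    by apply/funext => k; rewrite /set0at; case: eqP => // ->.
  apply/funext => k; rewrite /set0at; case: eqP => [->//|/eqP k0].
  by rewrite h // mem_seq1.
exists N => n m Nn Nm x y h; rewrite !rhoE //.
have [nm|mn] := leqP n m; first exact: (hN (x 0, y 0)).
by rewrite distrC; apply: (hN (x 0, y 0)) => //; exact: ltnW.
Qed.

(** The disjunction allows the shift to go either way, so that an induction over the integers can
    move the changed site both right and left. *)
Lemma ucauchy_step (s t : seq int) :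
  (forall x y, eqoff t x y -> exists x' y', [/\ eqoff s x' y' &
     (x' = sh 1 x /\ y' = sh 1 y) \/ (x = sh 1 x' /\ y = sh 1 y')]) ->
  ucauchy s -> ucauchy t.
Proof.
move=> st hs eps eps0; have e5 : 0 < eps / 5 by rewrite divr_gt0.
have [N1 h1] := hs _ e5; have [N2 h2] := phi_far s e5; have [N3 h3] := phi_far t e5.
exists (N1 + N2 + N3)%N => n m Nn Nm x y xy.
have [x' [y' [xy' hh]]] := st _ _ xy.
have := h1 n m ltac:(lia) ltac:(lia) _ _ xy'.
case: hh => [] [e1 e2].
  have a1 := h3 n.+1%:Z x y ltac:(lia) xy; have a2 := h3 (- n%:Z) x y ltac:(lia) xy.
  have a3 := h3 m.+1%:Z x y ltac:(lia) xy; have a4 := h3 (- m%:Z) x y ltac:(lia) xy.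
  rewrite e1 e2 !dsum_sh1; move: a1 a2 a3 a4; rewrite !ler_norml.
  move=> /andP[? ?] /andP[? ?] /andP[? ?] /andP[? ?] /andP[? ?].
  by apply/andP; split; lra.
have a1 := h2 n.+1%:Z x' y' ltac:(lia) xy'; have a2 := h2 (- n%:Z) x' y' ltac:(lia) xy'.
have a3 := h2 m.+1%:Z x' y' ltac:(lia) xy'; have a4 := h2 (- m%:Z) x' y' ltac:(lia) xy'.
rewrite e1 e2 !dsum_sh1; move: a1 a2 a3 a4; rewrite !ler_norml.
move=> /andP[? ?] /andP[? ?] /andP[? ?] /andP[? ?] /andP[? ?].
by apply/andP; split; lra.
Qed.

Lemma ucauchy1 (k : int) : ucauchy [:: k].
Proof.
elim/int_ind: k => [|n|n]; first exact: ucauchy0.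
- apply: ucauchy_step => x y xy; exists (sh 1 x), (sh 1 y); split; last by left.
  by move=> i; rewrite mem_seq1 => h; apply: xy; rewrite mem_seq1; apply: contra h => /eqP ?; apply/eqP; lia.
- apply: ucauchy_step => x y xy; exists (sh (-1) x), (sh (-1) y); split.
    by move=> i; rewrite mem_seq1 => h; apply: xy; rewrite mem_seq1; apply: contra h => /eqP ?; apply/eqP; lia.
  by right; rewrite !sh_sh subrr !sh0.
Qed.

(** The sites are changed one at a time through an intermediate configuration, and [dsum] is
    additive along such chains. *)
Lemma ucauchy_seq (s : seq int) : ucauchy s.
Proof.
elim: s => [|k s IH].
  move=> eps eps0; exists 0%N => n m _ _ x y xy.
  have -> : x = y by apply/funext => k; apply: xy.
  by rewrite !dsumxx subrr normr0 ltW.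
move=> eps eps0; have e2 : 0 < eps / 2 by rewrite divr_gt0.
have [N1 h1] := ucauchy1 k e2; have [N2 h2] := IH _ e2.
exists (maxn N1 N2) => n m; rewrite !geq_max => /andP[n1 n2] /andP[m1 m2] x y xy.
pose z : Omega e0 := fun i => if i == k then y i else x i.
have xz : eqoff [:: k] x z by move=> i; rewrite mem_seq1 /z => /negbTE ->.
have zy : eqoff s z y.
  move=> i si; rewrite /z; case: eqP => // /eqP ik; apply: xy.
  by rewrite inE negb_or ik.
rewrite -(dsumD n x z y) -(dsumD m x z y).
have := h1 _ _ n1 m1 _ _ xz; have := h2 _ _ n2 m2 _ _ zy.
rewrite !ler_norml => /andP[? ?] /andP[? ?]; apply/andP; split; lra.
Qed.

(** This is the relative energy of [x] against [y]. It carries meaning for pairs that differ at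
    finitely many sites, where [dsum_cvg] applies; otherwise [limn] may return its default value. *)
Definition Delta x y : R := limn (fun n => dsum n x y).

Lemma dsum_cvg (s : seq int) x y : eqoff s x y ->
  (fun n => dsum n x y) @ \oo --> Delta x y.
Proof.
move=> xy; apply: cauchy_cvg; apply/cauchy_exP => eps eps0.
have e2 : 0 < eps / 2 by rewrite divr_gt0.
have [N hN] := ucauchy_seq s e2.
exists (dsum N x y); exists N => // n /= Nn; rewrite /ball /=.
by rewrite (le_lt_trans (hN _ _ (leqnn _) Nn _ _ xy)) // gtr_pMr // invf_lt1 // ltr1n.
Qed.

Lemma Delta_approx (s : seq int) (eps : R) : 0 < eps -> exists N, forall n, (N <= n)%N ->
  forall x y, eqoff s x y -> `|dsum n x y - Delta x y| <= eps.
Proof.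
move=> eps0; have e2 : 0 < eps / 2 by rewrite divr_gt0.
have [N hN] := ucauchy_seq s e2; exists N => n Nn x y xy.
have /cvgrPdist_le /(_ _ e2) [M _ hM] := dsum_cvg xy.
have := hM (maxn N M) (leq_maxr _ _); have := hN n (maxn N M) Nn (leq_maxl _ _) _ _ xy.
rewrite /= !ler_norml => /andP[? ?] /andP[? ?]; apply/andP; split; lra.
Qed.

Lemma DeltaD (s : seq int) x y z : eqoff s x y -> eqoff s y z ->
  Delta x y + Delta y z = Delta x z.
Proof.
move=> xy yz; apply/esym/cvg_lim => //.
have -> : (fun n => dsum n x z) = (fun n => dsum n x y + dsum n y z).
  by apply/funext => n; rewrite dsumD.
by apply: cvgD; apply: dsum_cvg; eassumption.
Qed.

Lemma Deltaxx x : Delta x x = 0.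
Proof.
by have /(_ x x x) := @DeltaD [::]; move=> /(_ (@eqoff_refl _ _ _ _) (@eqoff_refl _ _ _ _)); lra.
Qed.

Lemma Delta_sh1 (s : seq int) x y : eqoff s x y ->
  Delta (sh 1 x) (sh 1 y) = Delta x y.
Proof.
move=> xy; apply/eqP; rewrite -subr_eq0 -normr_le0; apply/ler_addgt0Pr => eps eps0.
have e4 : 0 < eps / 4 by rewrite divr_gt0.
have xy' : eqoff [seq k - 1 | k <- s] (sh 1 x) (sh 1 y).
  move=> i h; apply: xy; apply: contra h => h.
  by apply/mapP; exists (i + 1) => //; rewrite addrK.
have [N1 h1] := Delta_approx s e4; have [N2 h2] := Delta_approx [seq k - 1 | k <- s] e4.
have [N3 h3] := phi_far s e4.
pose n := (N1 + N2 + N3)%N.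
have := h1 n ltac:(lia) _ _ xy; have := h2 n ltac:(lia) _ _ xy'.
have := h3 n.+1%:Z x y ltac:(lia) xy; have := h3 (- n%:Z) x y ltac:(lia) xy.
rewrite dsum_sh1 !ler_norml => /andP[? ?] /andP[? ?] /andP[? ?] /andP[? ?].
apply/andP; split; lra.
Qed.

Lemma Delta_shn (n : nat) (s : seq int) x y : eqoff s x y ->
  Delta (sh n%:Z x) (sh n%:Z y) = Delta x y.
Proof.
move=> xy; elim: n => [|n IH]; first by rewrite !sh0.
have xy' : eqoff [seq k - n%:Z | k <- s] (sh n%:Z x) (sh n%:Z y).
  move=> i h; apply: xy; apply: contra h => h.
  by apply/mapP; exists (i + n%:Z) => //; rewrite addrK.
have e : forall u : Omega e0, sh n.+1%:Z u = sh 1 (sh n%:Z u).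
  by move=> u; rewrite sh_sh; congr (sh _ u); lia.
by rewrite !e (Delta_sh1 xy').
Qed.

Lemma Delta_bounded (s : seq int) : exists2 B : R, 0 < B &
  forall x y, eqoff s x y -> `|Delta x y| <= B.
Proof.
have [N hN] := Delta_approx s ltr01; have [C C0 hC] := ucont_bounded phiu.
exists ((2 * N).+1%:R * (2 * C) + 1) => [|x y xy].
  by rewrite ltr_wpDl // mulr_ge0 // mulr_ge0 // ltW.
have := hN N (leqnn _) x y xy.
have : `|dsum N x y| <= (2 * N).+1%:R * (2 * C) + 0%:R * 0.
  have := @norm_sum_small R (fun j => phi (sh (j%:Z - N%:Z) x) - phi (sh (j%:Z - N%:Z) y))
    (2 * N).+1 0 (2 * C) (2 * C).
  have h2C k : `|phi (sh (k%:Z - N%:Z) x) - phi (sh (k%:Z - N%:Z) y)| <= 2 * C.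
    by rewrite (le_trans (ler_normB _ _)) // mulr2n mulrDl !mul1r lerD.
  by rewrite !mul0r; apply => //; rewrite mulr_ge0 // ltW.
rewrite mul0r !ler_norml => /andP[? ?] /andP[? ?]; apply/andP; split; lra.
Qed.

(** On pairs that differ only on [s], [Delta] is a uniform limit of the finite sums [dsum], each
    uniformly continuous. *)
Lemma Delta_ucont (s : seq int) (F G : Omega e0 -> Omega e0) :
  (forall N x y, agree N x y -> agree N (F x) (F y)) ->
  (forall N x y, agree N x y -> agree N (G x) (G y)) ->
  (forall x, eqoff s (F x) (G x)) ->
  ucont (fun x => Delta (F x) (G x)).
Proof.
move=> hF hG FG; apply: ucont_unif => eps eps0.
have [N hN] := Delta_approx s eps0.
exists (fun x => dsum N (F x) (G x)); last by move=> x; exact: hN.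
apply: ucont_sum => j _; apply: ucontD.
  apply: (@ucont_lift _ _ _ (phi \o sh (j%:Z - N%:Z)) F 0); last exact: ucont_sh.
  by move=> M x y; rewrite addn0; exact: hF.
have h : ucont (fun x => (-1) * (phi \o sh (j%:Z - N%:Z)) (G x)).
  apply: ucontM; first exact: ucont_cst.
  apply: (@ucont_lift _ _ _ (phi \o sh (j%:Z - N%:Z)) G 0); last exact: ucont_sh.
  by move=> M x y; rewrite addn0; exact: hG.
by apply: (eq_ucont _ h) => x; rewrite mulN1r.
Qed.

End Cocycle.

(** * Birkhoff sums and their comparison with the cocycle *)

Section Birkhoff.
Context {E : finType} {e0 : E} {R : realType}.
Variable phi : Omega e0 -> R.
Hypotheses (phiu : ucont phi) (phie : extensible phi).
Implicit Types x y z w : Omega e0.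

Lemma birkhoffE n x : birkhoff phi n x = \sum_(0 <= k < n) phi (sh k%:Z x).
Proof. by apply: eq_bigr => k _; rewrite iter_shiftE. Qed.

(** Shifts whose origin stays more than [M] sites away from both ends of the block see nearly equal
    values; the at most $2M$ remaining terms are bounded and are absorbed for large [n]. *)
Lemma birkhoff_variation (eps : R) : 0 < eps -> exists N, forall n, (N <= n)%N ->
  forall x y, (forall k : nat, (k < n)%N -> x k%:Z = y k%:Z) ->
    `|birkhoff phi n x - birkhoff phi n y| <= n%:R * eps.
Proof.
move=> eps0; have e2 : 0 < eps / 2 by rewrite divr_gt0.
have [M hM] := phiu e2; have [B B0 hB] := ucont_bounded phiu.
have [N hN] := eventually_le_linear (2 * M%:R * (2 * B)) e2.
exists N => n Nn x y xy.
pose a k := phi (sh k%:Z x) - phi (sh k%:Z y).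
(* [c] collects the terms near the right end of the block; the large terms of [b] can then only lie
   near the left end. *)
pose b k := if (k + M < n)%N then a k else 0.
pose c k := if (k + M < n)%N then 0 else a k.
have aB k : `|a k| <= 2 * B.
  by rewrite (le_trans (ler_normB _ _)) // mulr2n mulrDl !mul1r lerD.
have B20 : 0 <= 2 * B by rewrite mulr_ge0 // ltW.
have -> : birkhoff phi n x - birkhoff phi n y =
    \sum_(0 <= k < n) b k + \sum_(0 <= k < n) c k.
  rewrite !birkhoffE -sumrB -big_split /=; apply: eq_bigr => k _.
  by rewrite /b /c; case: ifP; rewrite ?addr0 ?add0r.
have h1 : `|\sum_(0 <= k < n) b k| <= n%:R * (eps / 2) + M%:R * (2 * B).
  apply: norm_sum_small => //; first exact: ltW.
    move=> k kn Mk; rewrite /b; case: ifP => h; last by rewrite normr0 ltW.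
    apply: hM => i iM; rewrite /sh.
    have -> : i + k%:Z = (absz (i + k%:Z))%:Z by lia.
    by apply: xy; lia.
  by move=> k kn; rewrite /b; case: ifP => // _; rewrite normr0.
have h2 : `|\sum_(0 <= k < n) c k| <= n%:R * 0 + M%:R * (2 * B).
  rewrite big_nat_rev /=; apply: norm_sum_small => //.
    by move=> k kn Mk; rewrite /c; case: ifP => h; [rewrite normr0|lia].
  by move=> k kn; rewrite /c; case: ifP => // _; rewrite normr0.
rewrite (le_trans (ler_normD _ _)) //; have := hN n Nn; lra.
Qed.

Definition irange (n : nat) : seq int := [seq k%:Z | k <- iota 0 n].

Lemma mem_irange n k : (k \in irange n) = (0 <= k) && (k < n%:Z).
Proof.
apply/mapP/andP => [[j]|[k0 kn]]; first by rewrite mem_iota => /andP[? ?] ->; lia.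
by exists `|k|%N; [rewrite mem_iota|]; lia.
Qed.

(* Replacing [x] by [y] one site at a time, site [k] is handled with the sum over *)
(* the symmetric window [k - n, k + n]; summation by parts over [k] shows that    *)
(* the mismatch between these windows costs only O(n) terms, most of them small.  *)
Lemma Delta_birkhoff (eps : R) : 0 < eps -> exists N, forall n, (N <= n)%N ->
  forall x y, eqoff (irange n) x y ->
    `|Delta phi x y - (birkhoff phi n x - birkhoff phi n y)| <= n%:R * eps.
Proof.
(* The five shares pay for the window errors [s6], the three boundary sums [s1], [s2], [s3], and the
   remainder independent of [n] bounded by [hN2]. *)
move=> eps0; have e5 : 0 < eps / 5 by rewrite divr_gt0.
have [M hM] := phiu e5; have [B B0 hB] := ucont_bounded phiu.
have [N1 hN1] := Delta_approx phiu phie [:: 0] e5.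
have [N2 hN2] := eventually_le_linear (3 * M%:R * (2 * B) + 2 * B) e5.
exists (maxn N1 N2) => n; rewrite geq_max => /andP[n1 n2] x y xy.
have B20 : 0 <= 2 * B by rewrite mulr_ge0 // ltW.
have phiB (u v : Omega e0) : `|phi u - phi v| <= 2 * B.
  by rewrite (le_trans (ler_normB _ _)) // mulr2n mulrDl !mul1r lerD.
(* These configurations interpolate from [x] at $k=0$ to [y] at $k=n$; consecutive ones differ at
   most at site [k]. *)
pose z (k : nat) : Omega e0 := fun i => if (0 <= i) && (i < k%:Z) then y i else x i.
have z0 : z 0%N = x by apply/funext => i; rewrite /z; case: ifP => // /andP[]; lia.
have zn : z n = y.
  apply/funext => i; rewrite /z; case: ifP => // h.
  by apply: xy; rewrite mem_irange h.
have zS k : eqoff [:: k%:Z] (z k) (z k.+1).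
  move=> i; rewrite mem_seq1 => /eqP ik; rewrite /z.
  by have -> : (0 <= i) && (i < k.+1%:Z) = (0 <= i) && (i < k%:Z) by apply/idP/idP; lia.
have zy k : eqoff (irange n) (z k) y.
  by move=> i /xy; rewrite /z; case: ifP.
have zx k : eqoff (irange n) x (z k) := eqoff_trans xy (eqoff_sym (zy k)).
pose G (k : nat) (u : Omega e0) := \sum_(0 <= j < (2 * n).+1) phi (sh (j%:Z - n%:Z) (sh k%:Z u)).
have GS k u : G k.+1 u = G k u + (phi (sh (k%:Z + n.+1%:Z) u) - phi (sh (k%:Z - n%:Z) u)).
  pose T (i : int) := phi (sh (i + k%:Z - n%:Z) u).
  have e1 : G k.+1 u = \sum_(0 <= j < (2 * n).+1) T j.+1%:Z.
    apply: eq_bigr => j _; by rewrite sh_sh /T; congr (phi (sh _ u)); lia.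
  have e2 : G k u = \sum_(0 <= j < (2 * n).+1) T j%:Z.
    apply: eq_bigr => j _; by rewrite sh_sh /T; congr (phi (sh _ u)); lia.
  have : \sum_(0 <= j < (2 * n).+2) T j%:Z = T 0 + \sum_(0 <= j < (2 * n).+1) T j.+1%:Z.
    by rewrite big_nat_recl.
  rewrite big_nat_recr //= -e1 -e2 /T => h.
  have -> : k%:Z + n.+1%:Z = (2 * n).+1%:Z + k%:Z - n%:Z by lia.
  have -> : k%:Z - n%:Z = 0 + k%:Z - n%:Z by lia.
  lra.
have DG k u v : dsum phi n (sh k%:Z u) (sh k%:Z v) = G k u - G k v.
  by rewrite /dsum /G -sumrB.
have D1 k : Delta phi (z k) (z k.+1) = Delta phi (sh k%:Z (z k)) (sh k%:Z (z k.+1)).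
  by rewrite (Delta_shn phiu phie k (zS k)).
have D2 k : `|G k (z k) - G k (z k.+1) - Delta phi (z k) (z k.+1)| <= eps / 5.
  rewrite D1 -DG; apply: hN1 => // i; rewrite mem_seq1 => /eqP i0.
  by apply: zS; rewrite mem_seq1; apply/eqP; lia.
have D3 m : Delta phi x (z m) = \sum_(0 <= k < m) Delta phi (z k) (z k.+1).
  elim: m => [|m IH]; first by rewrite big_geq // z0 (Deltaxx phiu phie).
  rewrite big_nat_recr //= -IH (DeltaD phiu phie (zx m)) //.
  exact: eqoff_trans (zy m) (eqoff_sym (zy m.+1)).
pose d k := phi (sh (k%:Z + n.+1%:Z) (z k.+1)) - phi (sh (k%:Z + n.+1%:Z) y).
pose d' k := phi (sh (k%:Z - n%:Z) (z k.+1)) - phi (sh (k%:Z - n%:Z) y).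
(* Summation by parts: moving the window from [k] to [k + 1] changes [G] by one term at each end,
   collected in [d] and [d']. At $m=n$ the term [G m (z m) - G m y] vanishes because [z n] is
   [y]. *)
have D4 m : \sum_(0 <= k < m) (G k (z k) - G k (z k.+1)) =
    G 0%N x - G 0%N y - (G m (z m) - G m y) + (\sum_(0 <= k < m) d k - \sum_(0 <= k < m) d' k).
  elim: m => [|m IH]; first by rewrite !big_geq // z0; ring.
  by rewrite !big_nat_recr //= IH !GS /d /d'; ring.
have s1 : `|\sum_(0 <= k < n) d k| <= n%:R * (eps / 5) + M%:R * (2 * B).
  apply: norm_sum_small => //; first exact: ltW.
  move=> k kn Mk; apply: hM => i iM; apply: zy; rewrite mem_irange.
    by apply/negP => /andP[]; lia.
  by move=> k _; exact: phiB.
have s2 : `|\sum_(0 <= k < n) d' k| <= n%:R * (eps / 5) + M%:R * (2 * B).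
  rewrite big_nat_rev /=; apply: norm_sum_small => //; first exact: ltW.
  move=> k kn Mk; apply: hM => i iM; apply: zy; rewrite mem_irange.
    by apply/negP => /andP[]; lia.
  by move=> k _; exact: phiB.
pose b k := phi (sh (- k.+1%:Z) x) - phi (sh (- k.+1%:Z) y).
have s3 : `|\sum_(0 <= k < n) b k| <= n%:R * (eps / 5) + M%:R * (2 * B).
  apply: norm_sum_small => //; first exact: ltW.
  move=> k kn Mk; apply: hM => i iM; apply: xy; rewrite mem_irange.
    by apply/negP => /andP[]; lia.
  by move=> k _; exact: phiB.
have s4 : G 0%N x - G 0%N y = birkhoff phi n x - birkhoff phi n y
    + \sum_(0 <= k < n) b k + (phi (sh n%:Z x) - phi (sh n%:Z y)).
  rewrite /G -sumrB !birkhoffE.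
  rewrite (@big_cat_nat _ _ _ n) //=; last by lia.
  rewrite big_nat_rev /=.
  have -> : \sum_(0 <= i < n) (phi (sh ((0 + n - i.+1)%N%:Z - n%:Z) (sh 0 x))
      - phi (sh ((0 + n - i.+1)%N%:Z - n%:Z) (sh 0 y))) = \sum_(0 <= k < n) b k.
    apply: eq_big_nat => k kn; rewrite !sh0 /b.
    by have -> : (0 + n - k.+1)%N%:Z - n%:Z = - k.+1%:Z by lia.
  have big_shift (F : nat -> R) :
      \sum_(n <= i < (2 * n).+1) F i = \sum_(0 <= i < n.+1) F (i + n)%N.
    by rewrite -{1}[n]add0n big_addn; have -> : ((2 * n).+1 - n)%N = n.+1 by lia.
  rewrite big_shift big_nat_recr //=.
  have e (k : nat) : (k + n)%N%:Z - n%:Z = k%:Z by lia.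
  rewrite e !sh0 -sumrB.
  have -> : \sum_(0 <= i < n) (phi (sh ((i + n)%N%:Z - n%:Z) x)
      - phi (sh ((i + n)%N%:Z - n%:Z) y)) =
      \sum_(0 <= i < n) (phi (sh i%:Z x) - phi (sh i%:Z y)).
    by apply: eq_bigr => i _; rewrite e.
  by ring.
have s5 := phiB (sh n%:Z x) (sh n%:Z y).
have s6 : `|\sum_(0 <= k < n) (G k (z k) - G k (z k.+1) - Delta phi (z k) (z k.+1))|
    <= n%:R * (eps / 5) + 0%:R * (eps / 5).
  by apply: norm_sum_small => //; exact: ltW.
have {}s6 : `|\sum_(0 <= k < n) (G k (z k) - G k (z k.+1)) - Delta phi x y|
    <= n%:R * (eps / 5) by move: s6; rewrite mul0r addr0 sumrB -D3 zn.
move: s6; rewrite D4 zn subrr subr0 s4.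
have := hN2 n n2; move: s1 s2 s3 s5; rewrite !ler_norml.
move=> /andP[? ?] /andP[? ?] /andP[? ?] /andP[? ?] ? /andP[? ?].
by apply/andP; split; lra.
Qed.

End Birkhoff.

(** * Splicing a finite word into a configuration *)

Section Glue.
Context {E : finType} {e0 : E}.
Implicit Types x y z w : Omega e0.

Lemma glue_notin (L : {fset int}) (xi : {ffun L -> E}) w k :
  k \notin L -> glue xi w k = w k.
Proof. by move=> kL; rewrite /glue insubN. Qed.

Lemma glue_val (L : {fset int}) (xi : {ffun L -> E}) w (s : L) :
  glue xi w (val s) = xi s.
Proof. by rewrite /glue valK. Qed.

Lemma restr_glue (L : {fset int}) (xi : {ffun L -> E}) w : restr L (glue xi w) = xi.
Proof. by apply/ffunP => s; rewrite ffunE glue_val. Qed.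

Lemma glue_restr_in (L : {fset int}) x w k : k \in L -> glue (restr L x) w k = x k.
Proof. by move=> kL; rewrite -[k]/(val [` kL]%fset) glue_val ffunE. Qed.

Lemma glue_eqoff (L : {fset int}) (xi : {ffun L -> E}) w : eqoff L (glue xi w) w.
Proof. by move=> k; exact: glue_notin. Qed.

Lemma glue_restr (L : {fset int}) x w : eqoff L x w -> glue (restr L x) w = x.
Proof.
move=> xw; apply/funext => k; case: (boolP (k \in L)) => kL.
  exact: glue_restr_in.
by rewrite glue_notin // xw.
Qed.

Lemma eq_glue (L : {fset int}) (xi : {ffun L -> E}) w w' :
  eqoff L w w' -> glue xi w = glue xi w'.
Proof.
move=> h; apply/funext => k; rewrite /glue; case: insubP => // kL.
exact: h.
Qed.

Lemma glue_glue (L D : {fset int}) (xi : {ffun L -> E}) (zeta : {ffun D -> E}) w :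
  (L `<=` D)%fset -> glue zeta (glue xi w) = glue zeta w.
Proof.
move=> LD; apply: eq_glue => k kD; apply: glue_notin.
by apply: contra kD; exact: (fsubsetP LD).
Qed.

Lemma agree_glue (L : {fset int}) (xi : {ffun L -> E}) N x y :
  agree N x y -> agree N (glue xi x) (glue xi y).
Proof. by move=> h k kN; rewrite /glue; case: insubP => // _; exact: h. Qed.

End Glue.

(** * The specification with relative weights $e^{\Delta}$ *)

Section Specification.
Context {E : finType} {e0 : E} {R : realType}.
Variable phi : Omega e0 -> R.
Hypotheses (phiu : ucont phi) (phie : extensible phi).
Implicit Types x y z w : Omega e0.

Let W b x := expR (Delta phi x b).

(** Energies exist only relative to another configuration, so the boundary condition [w] itself
    serves as the reference. *)
Definition gibbs_spec : spec_type e0 R := fun L xi w =>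
  expR (Delta phi (glue xi w) w) / \sum_(eta : {ffun L -> E}) expR (Delta phi (glue eta w) w).

Lemma sum_expR_gt0 (L : {fset int}) (F : {ffun L -> E} -> R) :
  0 < \sum_eta expR (F eta).
Proof.
have x0 : {ffun L -> E} := [ffun => e0].
rewrite (bigD1 x0) //= ltr_wpDr ?expR_gt0 // sumr_ge0 // => i _; exact: expR_ge0.
Qed.

(** By additivity of [Delta], replacing the reference [w] by [b] multiplies numerator and
    denominator by the same factor. A common reference is what lets kernels with different boundary
    conditions or volumes be compared. *)
Lemma gibbs_specE (s : seq int) (L : {fset int}) (xi : {ffun L -> E}) w b :
  {subset L <= s} -> eqoff s w b ->
  gibbs_spec xi w = W b (glue xi w) / \sum_(eta : {ffun L -> E}) W b (glue eta w).
Proof.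
move=> Ls wb; rewrite /gibbs_spec /W.
have gE (eta : {ffun L -> E}) : expR (Delta phi (glue eta w) w) =
    expR (- Delta phi w b) * expR (Delta phi (glue eta w) b).
  have <- := DeltaD phiu phie (eqoff_sub Ls (@glue_eqoff _ _ _ eta w)) wb.
  by rewrite -expRD; congr expR; ring.
rewrite gE; under eq_bigr do rewrite gE.
rewrite -mulr_sumr invfM mulrACA divff ?mul1r // gt_eqF //; exact: expR_gt0.
Qed.

Lemma gibbs_spec_gt0 (L : {fset int}) (xi : {ffun L -> E}) w : 0 < gibbs_spec xi w.
Proof. by rewrite divr_gt0 ?expR_gt0 ?sum_expR_gt0. Qed.

Lemma gibbs_spec_sum1 (L : {fset int}) w : \sum_(xi : {ffun L -> E}) gibbs_spec xi w = 1.
Proof. by rewrite -mulr_suml divff // gt_eqF // sum_expR_gt0. Qed.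

Lemma gibbs_spec_off (L : {fset int}) (xi : {ffun L -> E}) w w' :
  eqoff L w w' -> gibbs_spec xi w = gibbs_spec xi w'.
Proof.
move=> h; rewrite (@gibbs_specE L _ xi w w') // (@gibbs_specE L _ xi w' w') //.
by rewrite (eq_glue _ h); under eq_bigr do rewrite (eq_glue _ h).
Qed.

(* The weights of two configurations that agree off [D] appear symmetrically, *)
(* hence the involution that swaps them.                                      *)
Lemma gibbs_spec_consistent (L D : {fset int}) (f : Omega e0 -> R) w :
  (D `<=` L)%fset ->
  spec_apply gibbs_spec L (spec_apply gibbs_spec D f) w = spec_apply gibbs_spec L f w.
Proof.
move=> DL; have DLs : {subset D <= L} by exact/fsubsetP.
rewrite /spec_apply.
pose Z := \sum_(eta : {ffun L -> E}) W w (glue eta w).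
pose Z' x := \sum_(eta : {ffun D -> E}) W w (glue eta x).
pose A x x' := W w x / Z * (W w x' / Z' x * f x').
have gg (xi : {ffun L -> E}) (zeta : {ffun D -> E}) :
    eqoff L (glue zeta (glue xi w)) w.
  apply: eqoff_trans (@glue_eqoff _ _ _ xi w).
  exact: eqoff_sub (@glue_eqoff _ _ _ zeta _).
have -> : \sum_(xi : {ffun L -> E}) gibbs_spec xi w *
     (\sum_(zeta : {ffun D -> E}) gibbs_spec zeta (glue xi w) * f (glue zeta (glue xi w)))
   = \sum_(xi : {ffun L -> E}) \sum_(zeta : {ffun D -> E})
       A (glue xi w) (glue zeta (glue xi w)).
  apply: eq_bigr => xi _; rewrite mulr_sumr; apply: eq_bigr => zeta _.
  rewrite (@gibbs_specE L L xi w w) //.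
  by rewrite (@gibbs_specE L D zeta (glue xi w) w) //; exact: glue_eqoff.
(* The letters of [xi] on [D] are exchanged with [zeta], so the two glued configurations trade
   places. *)
pose tau (p : {ffun L -> E} * {ffun D -> E}) :=
  (restr L (glue p.2 (glue p.1 w)), restr D (glue p.1 w)).
have tauK : involutive tau.
  move=> [xi zeta]; rewrite /tau /= (glue_restr (gg _ _)).
  congr pair; last exact: restr_glue.
  rewrite glue_glue // glue_restr ?restr_glue //.
rewrite pair_big /= (reindex_inj (inv_inj tauK)) /=.
rewrite -(pair_big xpredT xpredT (fun (xi : {ffun L -> E}) (zeta : {ffun D -> E}) =>
   A (glue (restr L (glue zeta (glue xi w))) w)
     (glue (restr D (glue xi w)) (glue (restr L (glue zeta (glue xi w))) w)))) /=.
apply: eq_bigr => xi _.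
have Z'0 : Z' (glue xi w) != 0 by rewrite gt_eqF // sum_expR_gt0.
transitivity (\sum_(zeta : {ffun D -> E}) (W w (glue zeta (glue xi w)) *
    (W w (glue xi w) / Z * f (glue xi w) / Z' (glue xi w)))).
  apply: eq_bigr => zeta _; rewrite (glue_restr (gg _ _)) (@glue_glue _ _ D D) // glue_restr //.
  rewrite /A; have -> : Z' (glue zeta (glue xi w)) = Z' (glue xi w).
    by apply: eq_bigr => eta _; rewrite (@glue_glue _ _ D D).
  by ring.
rewrite -mulr_suml -/(Z' _) (@gibbs_specE L L xi w w) // -/Z.
by rewrite mulrC divfK.
Qed.

Lemma spec_apply_indep (D : {fset int}) (h g : Omega e0 -> R) x :
  (forall zeta : {ffun D -> E}, h (glue zeta x) = h x) ->
  spec_apply gibbs_spec D (fun y => h y * g y) x = h x * spec_apply gibbs_spec D g x.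
Proof.
move=> hh; rewrite /spec_apply mulr_sumr; apply: eq_bigr => zeta _.
by rewrite hh mulrCA.
Qed.

Lemma gibbs_spec_ucont (L : {fset int}) (xi : {ffun L -> E}) : ucont (gibbs_spec xi).
Proof.
have eu (eta : {ffun L -> E}) : ucont (fun w => expR (Delta phi (glue eta w) w)).
  apply: (@ucont_comp _ _ _ (@expR R) (fun w => Delta phi (glue eta w) w)).
    by move=> x; exact: continuous_expR.
  apply: (Delta_ucont phiu phie (s := L)) => //.
    by move=> N x y; exact: agree_glue.
  by move=> x; exact: glue_eqoff.
apply: ucontM; first exact: eu.
apply: (@ucont_comp _ _ _ (@GRing.inv R)
   (fun w => \sum_(eta : {ffun L -> E}) expR (Delta phi (glue eta w) w))).
  by move=> x; apply: inv_continuous; rewrite gt_eqF // sum_expR_gt0.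
by apply: ucont_sum => eta _.
Qed.

Lemma gibbs_spec_restrE (L : {fset int}) w :
  gibbs_spec (restr L w) w = (\sum_(eta : {ffun L -> E}) expR (Delta phi (glue eta w) w))^-1.
Proof. by rewrite /gibbs_spec glue_restr // (Deltaxx phiu phie) expR0 mul1r. Qed.

Lemma spec_apply_ucont (L : {fset int}) (f : Omega e0 -> R) :
  ucont f -> ucont (spec_apply gibbs_spec L f).
Proof.
move=> fu; apply: ucont_sum => xi _; apply: ucontM; first exact: gibbs_spec_ucont.
by apply: (@ucont_lift _ _ _ f (glue xi) 0) => // N x y; rewrite addn0; exact: agree_glue.
Qed.

Lemma gibbs_spec_gibbsian : gibbsian_spec gibbs_spec.
Proof.
split; first split.
- by move=> L xi w w'; exact: gibbs_spec_off.
- split; first by move=> L xi w; exact/ltW/gibbs_spec_gt0.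
  split; first by move=> L w; exact: gibbs_spec_sum1.
  by move=> L D DL f _ _ w; exact: gibbs_spec_consistent.
- split=> L.
    have [B B0 hB] := Delta_bounded phiu phie L.
    exists (#|{ffun L -> E}|%:R * expR B)^-1.
      rewrite invr_gt0 mulr_gt0 ?expR_gt0 // ltr0n.
      by apply/card_gt0P; exists [ffun => e0].
    move=> w; rewrite gibbs_spec_restrE lef_pV2 ?posrE ?sum_expR_gt0 //; last first.
      rewrite mulr_gt0 ?expR_gt0 // ltr0n.
      by apply/card_gt0P; exists [ffun => e0].
    rewrite mulr_natl -sumr_const; apply: ler_sum => eta _.
    by rewrite ler_expR (le_trans (ler_norm _)) // hB //; exact: glue_eqoff.
  apply: ucont_continuous.
  (* The word [restr L w] itself varies with [w]; summing over all words against locally constant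
     indicators reduces the claim to a fixed word. *)
  have h : ucont (fun w => \sum_(xi : {ffun L -> E}) (gibbs_spec xi w *
      (restr L w == xi)%:R)).
    apply: ucont_sum => xi _; apply: ucontM; first exact: gibbs_spec_ucont.
    move=> eps eps0; have [K hK] := seq_int_bounded L; exists K => x y xy.
    have -> : restr L x = restr L y.
      by apply/ffunP => s; rewrite !ffunE xy //; apply: hK; exact: valP.
    by rewrite subrr normr0 ltW.
  apply: (eq_ucont _ h) => w; rewrite (bigD1 (restr L w)) //= eqxx mulr1 big1 ?addr0 //.
  by move=> xi xw; rewrite eq_sym (negbTE xw) mulr0.
Qed.

End Specification.

(** * Measurability of local sets, shifts and continuous functions *)

Section Measurability.
Context {E : finType} {e0 : E} {R : realType}.
Implicit Types x y z w : Omega e0.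

Lemma open_agree (A : set (Omega e0)) :
  (forall x, A x -> exists N, agree N x `<=` A) -> open A.
Proof.
move=> h; rewrite openE => x /h [N hN].
exact: filterS hN (nbhs_agree N x).
Qed.

Lemma open_measurable_Omega (A : set (Omega e0)) :
  open A -> measurable (A : set (OmegaM e0)).
Proof. by move=> oA; apply: sub_sigma_algebra. Qed.

Definition local (N : nat) (D : set (Omega e0)) := forall x y, agree N x y -> D x -> D y.

Lemma local_measurable N (D : set (Omega e0)) :
  local N D -> measurable (D : set (OmegaM e0)).
Proof.
move=> lD; apply: open_measurable_Omega; apply: open_agree => x Dx.
by exists N => y xy; apply: lD Dx.
Qed.

Lemma measurable_fun_sh (k : int) :
  measurable_fun setT (sh k : OmegaM e0 -> OmegaM e0).
Proof.
apply: (@measurability _ _ (OmegaM e0) (OmegaM e0) setT (sh k) (@open (Omega e0))) => //.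
move=> _ [U oU <-]; rewrite setTI; apply: open_measurable_Omega.
apply: open_agree => x /= Ux.
have /nbhs_agreeP [N hN] : nbhs (sh k x) U by apply: open_nbhs_nbhs.
by exists (N + `|k|)%N => y xy; apply: hN; exact: agree_sh.
Qed.

Lemma ucont_measurable (f : Omega e0 -> R) :
  ucont f -> measurable_fun setT (f : OmegaM e0 -> R).
Proof.
move=> /ucont_continuous fc; apply: (@measurability _ _ (OmegaM e0) R setT f (@RGenOpens.G R)).
  exact: RGenOpens.measurableE.
move=> _ [_ [a [b ->]] <-]; rewrite setTI; apply: open_measurable_Omega.
by apply: open_comp => [x _|]; [exact: fc|exact: itv_open].
Qed.

End Measurability.

(** * Expectations of bounded functions and laws of finite-valued variables *)

Section Expectation.
Context {E : finType} {e0 : E} {R : realType}.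
Variable mu : probability (OmegaM e0) R.
Implicit Types x y z w : Omega e0.

Definition bmeas (f : OmegaM e0 -> R) :=
  measurable_fun setT f /\ exists B : R, forall x, `|f x| <= B.

Definition Ex (f : OmegaM e0 -> R) : R := Rintegral mu setT f.

Definition pr (A : set (OmegaM e0)) : R := fine (mu A).

Lemma mu_fin (A : set (OmegaM e0)) : measurable A -> mu A = (pr A)%:E.
Proof.
move=> mA; rewrite /pr fineK // ge0_fin_numE //.
by rewrite (le_lt_trans (probability_le1 mu mA)) // ltry.
Qed.

Lemma mu_lty (A : set (OmegaM e0)) : measurable A -> (mu A < +oo)%E.
Proof. by move=> mA; rewrite mu_fin // ltry. Qed.

Lemma pr_ge0 A : 0 <= pr A. Proof. exact: fine_ge0. Qed.

Lemma pr_setT : pr setT = 1. Proof. by rewrite /pr probability_setT. Qed.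

Lemma pr_le A B : measurable A -> measurable B -> A `<=` B -> pr A <= pr B.
Proof.
move=> mA mB AB; rewrite -lee_fin -!mu_fin //.
by apply: le_measure => //; rewrite inE.
Qed.

Lemma pr_setU A B : measurable A -> measurable B -> pr (A `|` B) <= pr A + pr B.
Proof.
move=> mA mB; rewrite -lee_fin EFinD -!mu_fin //; last exact: measurableU.
exact: measureU2.
Qed.

Lemma pr_bigsetU (I : Type) (s : seq I) (F : I -> set (OmegaM e0)) :
  (forall i, measurable (F i)) ->
  pr (\big[setU/set0]_(i <- s) F i) <= \sum_(i <- s) pr (F i).
Proof.
move=> mF; elim: s => [|i s IH]; first by rewrite !big_nil /pr measure0.
rewrite !big_cons (le_trans (pr_setU _ _)) ?lerD2l //.
by elim/big_ind: _ => //; exact: measurableU.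
Qed.

Lemma pr_cvg_bigcup (F : nat -> set (OmegaM e0)) (eps : R) : 0 < eps ->
  (forall n, measurable (F n)) -> (forall n m, (n <= m)%N -> F n `<=` F m) ->
  exists n, pr ((\bigcup_k F k) `\` F n) < eps.
Proof.
move=> eps0 mF hF; have mU : measurable (\bigcup_k F k) by exact: bigcupT_measurable.
have : (mu \o F) @ \oo --> mu (\bigcup_k F k).
  by apply: nondecreasing_cvg_mu => // n m nm; apply/subsetPset; exact: hF.
rewrite (mu_fin mU) => /fine_cvg /cvgrPdist_lt /(_ _ eps0) [n _ hn].
exists n; have := hn n (leqnn _) => /=; rewrite -/(pr _) => h.
have -> : pr (\bigcup_k F k `\` F n) = pr (\bigcup_k F k) - pr (F n).
  apply: EFin_inj; rewrite EFinB -!mu_fin //; last exact: measurableD.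
  rewrite measureD //; last exact: mu_lty.
  by congr (_ - mu _)%E; rewrite setIidr //; exact: bigcup_sup.
by rewrite (le_lt_trans (ler_norm _)).
Qed.

Lemma bmeas_integrable f : bmeas f -> mu.-integrable setT (EFin \o f).
Proof.
move=> [mf [B hB]]; apply: measurable_bounded_integrable => //.
  exact: mu_lty.
exists B; split; first exact: num_real.
by move=> M BM x _ /=; rewrite (le_trans (hB x)) // ltW.
Qed.

Lemma bmeas_cst c : bmeas (fun=> c).
Proof. by split; [exact: measurable_cst|exists `|c|]. Qed.

Lemma bmeasD f g : bmeas f -> bmeas g -> bmeas (fun x => f x + g x).
Proof.
move=> [mf [B hB]] [mg [C hC]]; split; first exact: measurable_funD.
by exists (B + C) => x; rewrite (le_trans (ler_normD _ _)) // lerD.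
Qed.

Lemma bmeasZ c f : bmeas f -> bmeas (fun x => c * f x).
Proof.
move=> [mf [B hB]]; split; first exact: measurable_funM.
by exists (`|c| * B) => x; rewrite normrM ler_wpM2l.
Qed.

Lemma bmeas_sum (I : Type) (s : seq I) (P : pred I) (f : I -> OmegaM e0 -> R) :
  (forall i, bmeas (f i)) -> bmeas (fun x => \sum_(i <- s | P i) f i x).
Proof.
move=> hf; elim: s => [|i s IH].
  rewrite (_ : (fun x => _) = fun=> 0); first exact: bmeas_cst.
  by apply/funext => x; rewrite big_nil.
case: (boolP (P i)) => Pi.
  rewrite (_ : (fun x => _) = fun x => f i x + \sum_(j <- s | P j) f j x).
    exact: bmeasD.
  by apply/funext => x; rewrite big_cons Pi.
rewrite (_ : (fun x => _) = fun x => \sum_(j <- s | P j) f j x) //.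
by apply/funext => x; rewrite big_cons (negbTE Pi).
Qed.

Lemma bmeas_sh k f : bmeas f -> bmeas (f \o sh k).
Proof.
move=> [mf [B hB]]; split; last by exists B => x; exact: hB.
by apply: measurableT_comp mf _; exact: measurable_fun_sh.
Qed.

Lemma ucont_bmeas (f : Omega e0 -> R) : ucont f -> bmeas f.
Proof.
move=> fu; split; first exact: ucont_measurable.
by have [B _ hB] := ucont_bounded fu; exists B.
Qed.

Lemma ExD f g : bmeas f -> bmeas g -> Ex (fun x => f x + g x) = Ex f + Ex g.
Proof. by move=> /bmeas_integrable hf /bmeas_integrable hg; apply: RintegralD. Qed.

Lemma ExZ c f : bmeas f -> Ex (fun x => c * f x) = c * Ex f.
Proof. by move=> /bmeas_integrable hf; apply: RintegralZl. Qed.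

Lemma Ex_cst c : Ex (fun=> c) = c.
Proof. by rewrite /Ex Rintegral_cst // -[fine _]/(pr setT) pr_setT mulr1. Qed.

Lemma Ex_le f g : bmeas f -> bmeas g -> (forall x, f x <= g x) -> Ex f <= Ex g.
Proof. by move=> /bmeas_integrable hf /bmeas_integrable hg fg; apply: le_Rintegral. Qed.

Lemma Ex_sum (I : Type) (s : seq I) (P : pred I) (f : I -> OmegaM e0 -> R) :
  (forall i, bmeas (f i)) ->
  Ex (fun x => \sum_(i <- s | P i) f i x) = \sum_(i <- s | P i) Ex (f i).
Proof.
move=> hf; elim: s => [|i s IH].
  rewrite big_nil -[RHS](Ex_cst 0); congr Ex.
  by apply/funext => x; rewrite big_nil.
rewrite big_cons; case: (boolP (P i)) => Pi.
  rewrite -IH -ExD //; last exact: bmeas_sum.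
  by congr Ex; apply/funext => x; rewrite big_cons Pi.
by rewrite -IH; congr Ex; apply/funext => x; rewrite big_cons (negbTE Pi).
Qed.

Lemma Ex_EFin f : bmeas f -> (\int[mu]_x (f x)%:E = (Ex f)%:E)%E.
Proof.
move=> /bmeas_integrable hf; rewrite /Ex /Rintegral fineK //.
exact: integrable_fin_num.
Qed.

Lemma Ex_indic (A : set (OmegaM e0)) : measurable A -> Ex (\1_A) = pr A.
Proof. by move=> mA; rewrite /Ex /Rintegral integral_indic // setIT. Qed.

Lemma bmeas_indic (A : set (OmegaM e0)) : measurable A -> bmeas (\1_A).
Proof.
move=> mA; split; first exact: measurable_indic.
exists 1 => x; rewrite indicE; case: (_ \in _); rewrite /= ?normr1 ?normr0 //.
Qed.

Definition rv (T : finType) (X : OmegaM e0 -> T) := forall t, measurable (X @^-1` [set t]).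

Lemma rv_measurable (T : finType) (X : OmegaM e0 -> T) (B : set T) :
  rv X -> measurable (X @^-1` B).
Proof.
move=> rX; rewrite (_ : X @^-1` B = \bigcup_(t in B) X @^-1` [set t]).
  by apply: fin_bigcup_measurable => //; exact: finite_finset.
apply/seteqP; split => x /=; first by move=> Bx; exists (X x).
by move=> [t Bt /= ->].
Qed.

Lemma rv_pair (T U : finType) (X : OmegaM e0 -> T) (Y : OmegaM e0 -> U) :
  rv X -> rv Y -> rv (fun x => (X x, Y x)).
Proof.
move=> rX rY [t u].
rewrite (_ : _ @^-1` _ = (X @^-1` [set t]) `&` (Y @^-1` [set u])).
  exact: measurableI.
by apply/seteqP; split => x /= [-> ->].
Qed.

Lemma rv_ffun (T : finType) n (X : 'I_n -> OmegaM e0 -> T) :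
  (forall i, rv (X i)) -> rv (fun x => [ffun i => X i x]).
Proof.
move=> rX c.
rewrite (_ : _ @^-1` _ = \bigcap_(i in [set: 'I_n]) (X i @^-1` [set c i])).
  by apply: fin_bigcap_measurable => [|i _]; [exact: finite_finset|exact: rX].
apply/seteqP; split => x /=; first by move=> <- i _ /=; rewrite ffunE.
by move=> h; apply/ffunP => i; rewrite ffunE; exact: h.
Qed.

Lemma rv_sh (T : finType) (X : OmegaM e0 -> T) k : rv X -> rv (X \o sh k).
Proof.
move=> rX t; rewrite -[X in measurable X]setTI comp_preimage.
exact: measurable_fun_sh.
Qed.

Lemma rv_local (T : finType) (X : OmegaM e0 -> T) N :
  (forall x y, agree N x y -> X x = X y) -> rv X.
Proof. by move=> hX t; apply: (@local_measurable _ _ N) => x y /hX /= ->. Qed.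

Lemma rv_restr (L : {fset int}) : rv (restr L : OmegaM e0 -> {ffun L -> E}).
Proof.
have [K hK] := seq_int_bounded L; apply: (@rv_local _ _ K) => x y xy.
by apply/ffunP => s; rewrite !ffunE xy //; apply: hK; exact: valP.
Qed.

Definition law (T : finType) (X : OmegaM e0 -> T) (t : T) : R := pr (X @^-1` [set t]).

Lemma rv_sumE (T : finType) (X : OmegaM e0 -> T) (g : T -> R) x :
  g (X x) = \sum_t g t * \1_(X @^-1` [set t]) x.
Proof.
rewrite (bigD1 (X x)) //= indicE mem_set //= mulr1 big1 ?addr0 // => t tX.
by rewrite indicE memNset ?mulr0 //= => h; rewrite h eqxx in tX.
Qed.

Lemma bmeas_rv (T : finType) (X : OmegaM e0 -> T) (g : T -> R) :
  rv X -> bmeas (fun x => g (X x)).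
Proof.
move=> rX; rewrite (_ : (fun x => _) = fun x => \sum_t g t * \1_(X @^-1` [set t]) x).
  by apply: bmeas_sum => t; apply: bmeasZ; exact: bmeas_indic.
by apply/funext => x; exact: rv_sumE.
Qed.

Lemma Ex_rv (T : finType) (X : OmegaM e0 -> T) (g : T -> R) :
  rv X -> Ex (fun x => g (X x)) = \sum_t law X t * g t.
Proof.
move=> rX; rewrite (_ : (fun x => _) = fun x => \sum_t g t * \1_(X @^-1` [set t]) x).
  rewrite Ex_sum => [|t]; last by apply: bmeasZ; apply: bmeas_indic; exact: rX.
  apply: eq_bigr => t _; rewrite ExZ; last by apply: bmeas_indic; exact: rX.
  by rewrite (Ex_indic (rX t)) mulrC.
by apply/funext => x; exact: rv_sumE.
Qed.

Lemma law_ge0 (T : finType) (X : OmegaM e0 -> T) t : 0 <= law X t.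
Proof. exact: pr_ge0. Qed.

Lemma law_sum1 (T : finType) (X : OmegaM e0 -> T) : rv X -> \sum_t law X t = 1.
Proof.
move=> rX; rewrite -(Ex_cst 1) (@Ex_rv _ X (fun=> 1)) //.
by apply: eq_bigr => t _; rewrite mulr1.
Qed.

Hypothesis mu_inv : shift_invariant mu.

Lemma pr_sh (n : nat) (A : set (OmegaM e0)) : measurable A ->
  pr (sh n%:Z @^-1` A) = pr A.
Proof.
move=> mA; elim: n => [|n IH].
  by congr pr; apply/seteqP; split => x /=; rewrite sh0.
rewrite -IH /pr -[in RHS]mu_inv; last first.
  by rewrite -[X in measurable X]setTI; exact: measurable_fun_sh.
congr (fine (mu _)); apply/seteqP; split => x /=;
  by rewrite -[Defs.shift x]/(iter 1 (@Defs.shift E e0) x) iter_shiftE sh_sh -PoszD addn1.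
Qed.

Lemma Ex_sh (n : nat) f : bmeas f -> Ex (f \o sh n%:Z) = Ex f.
Proof.
move=> bf; have mS := @measurable_fun_sh E e0 n%:Z.
rewrite /Ex /Rintegral; congr fine; apply/esym.
transitivity (\int[pushforward mu (sh n%:Z : OmegaM e0 -> OmegaM e0)]_x (f x)%:E)%E.
  apply: eq_measure_integral => A mA _.
  have mB : measurable ((sh n%:Z : OmegaM e0 -> OmegaM e0) @^-1` A).
    by rewrite -[X in measurable X]setTI; exact: mS.
  by apply: (etrans (mu_fin mA)); rewrite -(pr_sh n mA); exact: esym (mu_fin mB).
rewrite (@integral_pushforward _ _ _ _ _ _ mS mu setT (EFin \o f)) //.
- by apply/measurable_EFinP; case: bf.
- rewrite preimage_setT; exact: (bmeas_integrable (bmeas_sh n%:Z bf)).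
Qed.

Lemma law_sh (T : finType) (X : OmegaM e0 -> T) (n : nat) t :
  rv X -> law (X \o sh n%:Z) t = law X t.
Proof. by move=> rX; rewrite /law comp_preimage pr_sh. Qed.

End Expectation.

(** * Inequalities for the logarithm and for finite entropy *)

Section FiniteEntropy.
Context {R : realType}.

Lemma ln_le_subr1 (x : R) : 0 < x -> ln x <= x - 1.
Proof.
move=> x0; rewrite -{1}(subrKC 1 x); apply: le_ln1Dx; lra.
Qed.

(** The bound $\ln z\le z-1$ at $z=1/(1+y)$ leaves $y^2(1+2y)/(1+y)\ge0$ to check, which is where
    $y\ge-1/2$ enters. *)
Lemma ln1D_ge (y : R) : - (1 / 2) <= y -> y - 2 * y ^+ 2 <= ln (1 + y).
Proof.
move=> y2; have y1 : 0 < 1 + y by lra.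
have h : ln (1 + y)^-1 <= (1 + y)^-1 - 1 by apply: ln_le_subr1; rewrite invr_gt0.
rewrite lnV ?posrE // in h.
apply: (@le_trans _ _ (1 - (1 + y)^-1)); last lra.
rewrite -subr_ge0.
have -> : 1 - (1 + y)^-1 - (y - 2 * y ^+ 2) = y ^+ 2 * (1 + 2 * y) / (1 + y).
  by field; rewrite gt_eqF.
by rewrite divr_ge0 ?(ltW y1) // mulr_ge0 ?sqr_ge0 //; lra.
Qed.

(** Termwise $\ln(q/p)\le q/p-1$, multiplied by [p] and summed. *)
Lemma gibbs_ineq (T : finType) (p q : T -> R) :
  (forall t, 0 <= p t) -> \sum_t p t = 1 ->
  (forall t, 0 <= q t) -> \sum_t q t <= 1 -> (forall t, 0 < p t -> 0 < q t) ->
  \sum_t eta_fn (p t) <= \sum_t p t * - ln (q t).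
Proof.
move=> p0 p1 q0 q1 pq.
suff h t : eta_fn (p t) - p t * - ln (q t) <= q t - p t.
  rewrite -subr_le0 -sumrB (le_trans (ler_sum _ (fun t _ => h t))) //.
  by rewrite sumrB p1 subr_le0.
rewrite /eta_fn; case: eqP => [->|/eqP pt0]; first by rewrite mul0r !subr0.
have ppos : 0 < p t by rewrite lt_neqAle eq_sym pt0 p0.
have qpos := pq t ppos.
have : ln (q t / p t) <= q t / p t - 1 by apply: ln_le_subr1; rewrite divr_gt0.
rewrite ln_div ?posrE // -(ler_pM2l ppos) !mulrBr mulr1 mulrCA divff // mulr1.
lra.
Qed.

Lemma eta_fn_ge0 (x : R) : 0 <= x <= 1 -> 0 <= eta_fn x.
Proof.
move=> /andP[x0 x1]; rewrite /eta_fn; case: eqP => // _.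
by rewrite oppr_ge0 mulr_ge0_le0 // ln_le0.
Qed.

(** Each [p t] is at most the total, so its negative logarithm is at least that of the total. *)
Lemma eta_fn_sum (T : finType) (p : T -> R) : (forall t, 0 <= p t) ->
  eta_fn (\sum_t p t) <= \sum_t eta_fn (p t).
Proof.
move=> p0; rewrite {1}/eta_fn; case: eqP => [s0|/eqP s0].
  rewrite big1 // => t _; rewrite /eta_fn.
  by have /eqP := s0; rewrite psumr_eq0 // => /allP /(_ t); rewrite mem_index_enum => /(_ isT) /= ->.
have pl t : p t <= \sum_t p t by rewrite (bigD1 t) //= lerDl sumr_ge0.
rewrite -mulrN mulr_suml; apply: ler_sum => t _; rewrite /eta_fn.
case: eqP => [->|/eqP pt0]; first by rewrite mul0r.
rewrite -mulrN ler_wpM2l // lerN2 ler_ln ?posrE //.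
  by rewrite lt_neqAle eq_sym pt0 p0.
by rewrite lt_neqAle eq_sym s0 sumr_ge0.
Qed.

Lemma ln_prod (I : Type) (s : seq I) (f : I -> R) : (forall i, 0 < f i) ->
  ln (\prod_(i <- s) f i) = \sum_(i <- s) ln (f i).
Proof.
move=> f0; elim: s => [|i s IH]; first by rewrite !big_nil ln1.
by rewrite !big_cons lnM ?posrE ?IH // prodr_gt0.
Qed.

End FiniteEntropy.

(** * Block entropies, and approximation of measurable sets by local ones *)

Section Entropy.
Context {E : finType} {e0 : E} {R : realType}.
Variable mu : probability (OmegaM e0) R.
Implicit Types x y z w : Omega e0.

Definition ent (T : finType) (X : OmegaM e0 -> T) : R := \sum_t eta_fn (law mu X t).

Lemma law_le1 (T : finType) (X : OmegaM e0 -> T) t : rv X -> law mu X t <= 1.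
Proof. by move=> rX; rewrite -(pr_setT mu) pr_le. Qed.

Lemma ent_ge0 (T : finType) (X : OmegaM e0 -> T) : rv X -> 0 <= ent X.
Proof.
move=> rX; apply: sumr_ge0 => t _; apply: eta_fn_ge0.
by rewrite law_ge0 law_le1.
Qed.

Lemma ent_variational (T : finType) (X : OmegaM e0 -> T) (F : T -> R) : rv X ->
  ent X + Ex mu (fun x => F (X x)) <= ln (\sum_t expR (F t)).
Proof.
move=> rX; set Z := \sum_t _.
have Z0 : 0 < Z.
  rewrite /Z (bigD1 (X point)) //= ltr_wpDr ?expR_gt0 //.
  by apply: sumr_ge0 => t _; exact: expR_ge0.
have := @gibbs_ineq R T (law mu X) (fun t => expR (F t) / Z).
move=> /(_ (law_ge0 mu X) (law_sum1 mu rX)) h.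
have {}h : ent X <= \sum_t law mu X t * - ln (expR (F t) / Z).
  apply: h => [t||t _]; last by rewrite divr_gt0 ?expR_gt0.
    by rewrite divr_ge0 ?expR_ge0 // ltW.
  by rewrite -mulr_suml divff // gt_eqF.
rewrite Ex_rv // (le_trans (lerD h (lexx _))) // -big_split /=.
rewrite (eq_bigr (fun t => law mu X t * ln Z)) => [|t _].
  by rewrite -mulr_suml law_sum1 // mul1r.
by rewrite ln_div ?posrE ?expR_gt0 // expRK; ring.
Qed.

Lemma ent_pair_le (T U : finType) (X : OmegaM e0 -> T) (Y : OmegaM e0 -> U) :
  rv X -> rv Y -> ent X <= ent (fun x => (X x, Y x)).
Proof.
move=> rX rY; have rXY := rv_pair rX rY.
have lawE t : law mu X t = \sum_u law mu (fun x => (X x, Y x)) (t, u).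
  rewrite /law -Ex_indic //.
  transitivity (Ex mu (fun x => ((X x, Y x).1 == t)%:R)).
    congr (Ex mu _); apply/funext => x /=; rewrite indicE; congr (_%:R).
    by congr nat_of_bool; apply/idP/eqP => [/set_mem//|h]; apply/mem_set.
  rewrite (@Ex_rv _ _ _ _ _ (fun x => (X x, Y x)) (fun p => (p.1 == t)%:R)) //.
  rewrite (eq_bigr (fun p => law mu (fun x => (X x, Y x)) (p.1, p.2) * (p.1 == t)%:R));
    last by case.
  rewrite -(pair_bigA _ (fun t' u => law mu (fun x => (X x, Y x)) (t', u) * (t' == t)%:R)) /=.
  rewrite (bigD1 t) //= [X in _ + X]big1 ?addr0 => [|t' /negbTE ->].
    by apply: eq_bigr => u _; rewrite eqxx mulr1.
  by rewrite big1 // => u _; rewrite mulr0.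
rewrite /ent.
rewrite [leRHS](eq_bigr (fun p => eta_fn (law mu (fun x => (X x, Y x)) (p.1, p.2))));
  last by case.
rewrite -(pair_bigA _ (fun t u => eta_fn (law mu (fun x => (X x, Y x)) (t, u)))) /=.
apply: ler_sum => t _; rewrite lawE; apply: eta_fn_sum => u; exact: law_ge0.
Qed.

Definition Iset (n : nat) : {fset int} := [fset k in irange n]%fset.

Lemma mem_Iset n k : (k \in Iset n) = (0 <= k) && (k < n%:Z).
Proof. by rewrite inE /= mem_irange. Qed.

Definition block_ent (n : nat) : R := ent (restr (Iset n) : OmegaM e0 -> {ffun Iset n -> E}).

Lemma block_ent_ge0 n : 0 <= block_ent n.
Proof. by apply: ent_ge0; exact: rv_restr. Qed.

Lemma block_ent_le n : block_ent n <= n%:R * ln #|E|%:R.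
Proof.
have := @ent_variational _ _ (fun=> 0) (@rv_restr _ e0 (Iset n)).
rewrite Ex_cst addr0 => /le_trans; apply.
under eq_bigr do rewrite expR0.
rewrite sumr_const card_ffun -cardfE.
have -> : #|` Iset n| = n.
  rewrite card_fseq undup_id ?size_map ?size_iota //.
  by rewrite map_inj_uniq ?iota_uniq // => i j [].
have E0 : (0 < #|E|)%N by apply/card_gt0P; exists e0.
by rewrite natrX lnXn ?ltr0n // mulr_natl.
Qed.

Definition symdiff (A D : set (OmegaM e0)) := (A `\` D) `|` (D `\` A).

Definition approximable (A : set (OmegaM e0)) := measurable A /\
  forall eps : R, 0 < eps -> exists N D, local N D /\ pr mu (symdiff A D) < eps.

Lemma symdiff_measurable A D : measurable A -> measurable D -> measurable (symdiff A D).
Proof. by move=> mA mD; apply: measurableU; exact: measurableD. Qed.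

Lemma local_le N M (D : set (Omega e0)) : (N <= M)%N -> local N D -> local M D.
Proof. by move=> NM lD x y xy; apply: lD; exact: agree_le xy. Qed.

Lemma approximable0 : approximable set0.
Proof.
split=> // eps eps0; exists 0%N, set0; split => //.
by rewrite /symdiff !setD0 setU0 /pr measure0.
Qed.

Lemma approximableU A B : approximable A -> approximable B -> approximable (A `|` B).
Proof.
move=> [mA hA] [mB hB]; split; first exact: measurableU.
move=> eps eps0; have e2 : 0 < eps / 2 by rewrite divr_gt0.
have [N [D [lD hD]]] := hA _ e2; have [M [F [lF hF]]] := hB _ e2.
exists (maxn N M), (D `|` F); split.
  move=> x y xy [Dx|Fx]; [left|right].
    by apply: (local_le (leq_maxl N M) lD) Dx.
  by apply: (local_le (leq_maxr N M) lF) Fx.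
have mD := local_measurable lD; have mF := local_measurable lF.
have m1 := symdiff_measurable mA mD; have m2 := symdiff_measurable mB mF.
rewrite (@le_lt_trans _ _ (pr mu (symdiff A D) + pr mu (symdiff B F))) //; last lra.
apply: le_trans (pr_setU mu m1 m2); apply: pr_le.
- by apply: symdiff_measurable; exact: measurableU.
- exact: measurableU.
- move=> x; rewrite /symdiff /=.
  by case: (pselect (A x)); case: (pselect (B x)); case: (pselect (D x)); case: (pselect (F x)); tauto.
Qed.

Lemma approximable_bigcup (A : nat -> set (OmegaM e0)) :
  (forall n, approximable (A n)) ->
  (forall n m, (n <= m)%N -> A n `<=` A m) -> approximable (\bigcup_n A n).
Proof.
move=> hA mono; have mA n : measurable (A n) by case: (hA n).
have mU : measurable (\bigcup_n A n) by exact: bigcupT_measurable.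
split=> // eps eps0; have e2 : 0 < eps / 2 by rewrite divr_gt0.
have [n hn] := pr_cvg_bigcup mu e2 mA mono.
have [_ /(_ _ e2) [N [D [lD hD]]]] := hA n.
have mD := local_measurable lD; exists N, D; split => //.
have m1 : measurable ((\bigcup_n A n) `\` A n) by exact: measurableD.
have m2 := symdiff_measurable (mA n) mD.
rewrite (@le_lt_trans _ _ (pr mu ((\bigcup_n A n) `\` A n) + pr mu (symdiff (A n) D))) //; last lra.
apply: le_trans (pr_setU mu m1 m2); apply: pr_le.
- exact: symdiff_measurable.
- exact: measurableU.
- move=> x; rewrite /symdiff /setU /setD /=.
  have : A n x -> (\bigcup_n A n) x by move=> ?; exists n.
  by case: (pselect (A n x)); case: (pselect (D x)); tauto.
Qed.

(** The approximable sets form a sigma-algebra: countable unions are increasing limits of finite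
    ones, and $\mu$ is continuous along these. It contains every open [U], the increasing union of
    the local sets of points whose window of radius [n] stays in [U]. *)
Lemma measurable_approximable A : measurable A -> approximable A.
Proof.
apply: smallest_sub; first split.
- exact: approximable0.
- move=> B [mB hB]; rewrite setTD; split; first exact: measurableC.
  move=> eps /hB [N [D [lD hD]]]; exists N, (~` D); split.
    by move=> x y xy nD Dy; apply: nD; apply: lD Dy; exact: agree_sym.
  rewrite (_ : symdiff _ _ = symdiff B D) //.
  apply/seteqP; split => x; rewrite /symdiff /=;
    by case: (pselect (B x)); case: (pselect (D x)); tauto.
- move=> F hF; rewrite (_ : \bigcup_k F k = \bigcup_n \big[setU/set0]_(i < n.+1) F i).
    apply: approximable_bigcup.
      move=> n; elim: n.+1 => [|m IH]; first by rewrite big_ord0; exact: approximable0.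
      by rewrite big_ord_recr; exact: approximableU.
    by move=> n m nm; apply: subset_bigsetU.
  by rewrite bigcup_bigsetU_bigcup.
- move=> U oU.
  rewrite (_ : U = \bigcup_n [set x : OmegaM e0 | agree n x `<=` U]).
    have lA n : local n [set x : Omega e0 | agree n x `<=` U].
      move=> x y xy h z yz; apply: h; exact: agree_trans xy yz.
    apply: approximable_bigcup.
      move=> n; split; first exact: local_measurable (lA n).
      move=> eps eps0; exists n, [set x : Omega e0 | agree n x `<=` U]; split => //.
      by rewrite /symdiff setDv setU0 /pr measure0.
    by move=> n m nm x h y xy; apply: h; exact: agree_le xy.
  apply/seteqP; split => x; last by move=> [n _]; apply; exact: agree_refl.
  move=> Ux; have /nbhs_agreeP [N hN] : nbhs (x : Omega e0) U by apply: open_nbhs_nbhs.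
  by exists N.
Qed.

End Entropy.

(** * The Kolmogorov-Sinai entropy is at most the entropy rate of the blocks *)

Section KolmogorovSinai.
Context {E : finType} {e0 : E} {R : realType}.
Variable mu : probability (OmegaM e0) R.
Hypothesis mu_inv : shift_invariant mu.
Implicit Types x y z w : Omega e0.

Lemma partition_index (P : seq (set (OmegaM e0))) : is_partition P ->
  exists2 p : OmegaM e0 -> 'I_(size P), rv p &
    forall x i, nth set0 P i x <-> val (p x) = i.
Proof.
move=> [mP [dP cP]].
have /choice [p hp] : forall x, exists i : 'I_(size P), nth set0 P i x.
  by move=> x; have [i iP Px] := cP x; exists (Ordinal iP).
have pE x i : nth set0 P i x <-> val (p x) = i.
  split; last by move=> <-; exact: hp.
  move=> Px; apply/eqP/negP => /negP pi.
  have iP : (i < size P)%N.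
    by rewrite ltnNge; apply/negP => h; move: Px; rewrite nth_default.
  have := dP _ _ (ltn_ord (p x)) iP pi.
  by move=> /seteqP [/(_ x) h _]; apply: h; split.
exists p => // i; rewrite (_ : _ @^-1` _ = nth set0 P i); first exact: mP.
by apply/seteqP; split => x /=; [move=> <-; exact: hp|move=> /pE h; apply: val_inj].
Qed.

(** Each of the [r] atoms is approximated by a local set up to [eps / r]. Off the union of these
    errors a point lies in exactly the local set of its own atom. *)
Lemma rv_approx (r : nat) (p : OmegaM e0 -> 'I_r) (eps : R) : 0 < eps -> rv p ->
  exists N (Q : OmegaM e0 -> 'I_r), (forall x y, agree N x y -> Q x = Q y) /\
    pr mu [set x | p x != Q x] < eps.
Proof.
move=> eps0 rp; have r0 : (0 < r)%N by case: r p rp => // p _; case: (p point).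
have er : 0 < eps / r%:R by rewrite divr_gt0 // ltr0n.
have /choice [f hf] : forall i : 'I_r, exists ND : nat * set (Omega e0),
    local ND.1 ND.2 /\ pr mu (symdiff (p @^-1` [set i]) ND.2) < eps / r%:R.
  move=> i; have [_ /(_ _ er) [N [D hD]]] := measurable_approximable mu (rp i).
  by exists (N, D).
pose N := \max_(i < r) (f i).1.
(* The default [p point] is a constant, so [Q] remains local where no approximating set contains
   [x]. *)
pose Q x := odflt (p point) [pick i | `[< (f i).2 x >] ].
have lf i : local N (f i).2.
  by apply: local_le (hf i).1; exact: leq_bigmax.
have QN x y : agree N x y -> Q x = Q y.
  move=> xy; congr (odflt _ _); apply: eq_pick => i.
  by apply/asboolP/asboolP; apply: lf => //; exact: agree_sym.
have mf i : measurable (symdiff (p @^-1` [set i]) (f i).2).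
  by apply: symdiff_measurable; [exact: rp|exact: local_measurable (lf i)].
have rQ : rv Q by exact: rv_local QN.
exists N, Q; split => //.
apply: (@le_lt_trans _ _ (pr mu (\big[setU/set0]_(i < r) symdiff (p @^-1` [set i]) (f i).2))).
  apply: pr_le.
  - exact: (rv_measurable [set t : 'I_r * 'I_r | t.1 != t.2] (rv_pair rp rQ)).
  - by elim/big_ind: _ => //; exact: measurableU.
  - move=> x /= pQ; apply: contrapT => nU.
    have hD i : (f i).2 x <-> p x = i.
      apply: contrapT => hi; apply: nU; rewrite (bigD1 i) //=; left; rewrite /symdiff /=.
      by case: (pselect ((f i).2 x)) (pselect (p x = i)) => [a|a] [b|b]; tauto.
    move/negP: pQ; apply; rewrite /Q; case: pickP => [i /asboolP /hD -> //|h].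
    by move: (h (p x)) => /asboolP; have := hD (p x); tauto.
rewrite (le_lt_trans (pr_bigsetU _ _ mf)) //.
apply: (@lt_le_trans _ _ (\sum_(i < r) eps / r%:R)).
  apply: ltr_sum => [|i _]; last by case: (hf i).
  by apply/hasP; exists (Ordinal r0) => //; rewrite mem_index_enum.
by rewrite sumr_const card_ord -[_ *+ r]mulr_natr divfK // pnatr_eq0 -lt0n.
Qed.

Lemma eqoff_Iset n x y : eqoff (Iset n) x y -> eqoff (irange n) x y.
Proof. by apply: eqoff_sub => k; rewrite inE. Qed.

Lemma glue_Iset n x w (k : int) : 0 <= k -> k < n%:Z ->
  glue (restr (Iset n) x) w k = x k.
Proof. by move=> k0 kn; rewrite glue_restr_in // mem_Iset k0 kn. Qed.

(** A noisy guess: with probability $1-d$ the symbol is copied from [j], otherwise it is drawn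
    uniformly. All values are positive, so the cost [- ln] of a wrong guess is finite. *)
Definition kappa (r : nat) (d : R) (i j : 'I_r) : R := (1 - d) * (i == j)%:R + d / r%:R.

Lemma kappa_gt0 r (d : R) (i j : 'I_r) : 0 < d < 1 -> 0 < kappa d i j.
Proof.
move=> /andP[d0 d1]; have r0 : (0 < r)%N by case: r i j => // -[].
by rewrite ltr_wpDl ?divr_gt0 ?ltr0n // mulr_ge0 // subr_ge0 ltW.
Qed.

Lemma sum_kappa r (d : R) (j : 'I_r) : \sum_i kappa d i j = 1.
Proof.
have r0 : r%:R != 0 :> R by rewrite pnatr_eq0 -lt0n; case: r j => // -[].
rewrite big_split /= -mulr_sumr (bigD1 j) //= eqxx big1 => [|i /negbTE -> //].
have -> : true%:R = 1 :> R by [].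
by rewrite sumr_const card_ord -[_ *+ r]mulr_natr divfK //; ring.
Qed.

(* The reference measure on (name, word) pairs draws the word from [mu] and then *)
(* guesses each symbol of the name from a window of the word.                    *)
Lemma ent_name_le (r N n : nat) (p Q : OmegaM e0 -> 'I_r) (d : R) : 0 < d < 1 ->
  rv p -> (forall x y, agree N x y -> Q x = Q y) ->
  ent mu (fun x => [ffun k : 'I_n => p (sh k%:Z x)]) <=
    block_ent mu (n + 2 * N) + n%:R * Ex mu (fun x => - ln (kappa d (p x) (Q x))).
Proof.
move=> d01 rp QN; have rQ : rv Q by exact: rv_local QN.
set m := (n + 2 * N)%N.
pose X x : {ffun 'I_n -> 'I_r} := [ffun k : 'I_n => p (sh k%:Z x)].
have rX : rv X by apply: rv_ffun => k; exact: rv_sh.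
(* After a shift by [N], the window that determines the guess at time [k] is $[k,k+2N]$, which lies
   in the block $[0,m)$. *)
pose X' : OmegaM e0 -> {ffun 'I_n -> 'I_r} := X \o sh N%:Z.
have rX' : rv X' by exact: rv_sh.
have -> : ent mu (fun x => [ffun k : 'I_n => p (sh k%:Z x)]) = ent mu X'.
  by apply: eq_bigr => c _; rewrite law_sh.
pose A : OmegaM e0 -> {ffun Iset m -> E} := restr (Iset m).
have rA : rv A by exact: rv_restr.
apply: le_trans (ent_pair_le mu rX' rA) _.
pose w0 : Omega e0 := fun=> e0.
pose Qk (k : 'I_n) (a : {ffun Iset m -> E}) := Q (sh (k + N)%N%:Z (glue a w0)).
pose q (t : {ffun 'I_n -> 'I_r} * {ffun Iset m -> E}) :=
  law mu A t.2 * \prod_(k < n) kappa d (t.1 k) (Qk k t.2).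
have rXA := rv_pair rX' rA.
have pq t : 0 < law mu (fun x => (X' x, A x)) t -> 0 < law mu A t.2.
  move=> h; apply: lt_le_trans h _; apply: pr_le => //.
  by move=> x /= <-.
have prod0 (t : {ffun 'I_n -> 'I_r} * {ffun Iset m -> E}) : 0 < \prod_(k < n) kappa d (t.1 k) (Qk k t.2).
  by apply: prodr_gt0 => k _; exact: kappa_gt0.
have q0 t : 0 <= q t := mulr_ge0 (law_ge0 mu A t.2) (ltW (prod0 t)).
have q1 : \sum_t q t <= 1.
  rewrite /q -(pair_bigA _ (fun (c : {ffun 'I_n -> 'I_r}) (a : {ffun Iset m -> E}) =>
    law mu A a * \prod_(k < n) kappa d (c k) (Qk k a))) /=.
  rewrite exchange_big /= -[leRHS](law_sum1 mu rA) ler_sum // => a _.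
  rewrite -mulr_sumr -(bigA_distr_bigA (fun k j => kappa d j (Qk k a))) /=.
  by rewrite big1 ?mulr1 // => k _; exact: sum_kappa.
have qpos t : 0 < law mu (fun x => (X' x, A x)) t -> 0 < q t.
  by move=> /pq pt; exact: mulr_gt0 pt (prod0 t).
have h := gibbs_ineq (law_ge0 mu _) (law_sum1 mu rXA) q0 q1 qpos.
apply: le_trans h _.
pose G (t : {ffun 'I_n -> 'I_r} * {ffun Iset m -> E}) :=
  - ln (law mu A t.2) + \sum_(k < n) - ln (kappa d (t.1 k) (Qk k t.2)).
rewrite (eq_bigr (fun t => law mu (fun x => (X' x, A x)) t * G t)) => [|t _]; last first.
  have [->|pt] := eqVneq (law mu (fun x => (X' x, A x)) t) 0; first by rewrite !mul0r.
  have {}pt : 0 < law mu (fun x => (X' x, A x)) t by rewrite lt_neqAle eq_sym pt law_ge0.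
  rewrite /q lnM ?posrE ?pq // ln_prod => [|k]; last exact: kappa_gt0.
  by rewrite /G sumrN -opprD.
rewrite -Ex_rv //.
pose g (k : 'I_n) x := - ln (kappa d (p (sh (k + N)%N%:Z x)) (Q (sh (k + N)%N%:Z x))).
have GE : (fun x => G (X' x, A x)) = (fun x => - ln (law mu A (A x)) + \sum_(k < n) g k x).
  apply/funext => x; congr (_ + _); apply: eq_bigr => k _.
  rewrite /g /= /X' /X /= ffunE sh_sh PoszD; congr (- ln (kappa _ _ _)).
  apply: QN => i iN; rewrite /sh glue_Iset //; have := ltn_ord k; lia.
have bk : bmeas (fun x => - ln (kappa d (p x) (Q x))).
  exact: (bmeas_rv (fun t => - ln (kappa d t.1 t.2)) (rv_pair rp rQ)).
have bg k : bmeas (g k) by exact: (bmeas_sh (k + N)%N%:Z bk).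
have bA : bmeas (fun x => - ln (law mu A (A x))).
  exact: (bmeas_rv (fun a => - ln (law mu A a)) rA).
rewrite GE ExD //; last exact: bmeas_sum.
rewrite Ex_sum // (@Ex_rv _ _ _ _ _ A (fun a => - ln (law mu A a))) //.
have -> : \sum_t law mu A t * - ln (law mu A t) = block_ent mu m.
  apply: eq_bigr => a _; rewrite /eta_fn; case: eqP => [->|_]; first by rewrite mul0r.
  by rewrite mulrN.
rewrite lerD2l (eq_bigr (fun=> Ex mu (fun x => - ln (kappa d (p x) (Q x))))).
  by rewrite sumr_const card_ord mulr_natl.
by move=> k _; exact: (Ex_sh mu_inv (k + N)%N bk).
Qed.

Lemma join_entropy_le (P : seq (set (OmegaM e0))) (eps : R) : 0 < eps ->
  is_partition P -> exists N, forall n,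
    join_entropy mu P n <= block_ent mu (n + 2 * N) + n%:R * eps.
Proof.
move=> eps0 hP; have [p rp pE] := partition_index hP.
set r := size P in p rp pE.
have r0 : (0 < r)%N by exact: leq_ltn_trans (leq0n _) (ltn_ord (p point)).
have r0R : 1 <= r%:R :> R by rewrite ler1n.
(* This choice makes the cost $-\ln(1-d)$ of a correct guess equal to [eps / 2]. A wrong guess costs
   at most $-\ln(d/r)$, and [del] below makes its mean contribution at most [eps / 2]; the added $1$
   in its denominator keeps that denominator positive. *)
pose d := 1 - expR (- (eps / 2)).
have e2 : 0 < eps / 2 by rewrite divr_gt0.
have d01 : 0 < d < 1.
  by rewrite subr_gt0 expR_lt1 oppr_lt0 e2 /= ltrBlDr ltrDl expR_gt0.
have [d0 d1] := andP d01.
have dr0 : 0 < d / r%:R by rewrite divr_gt0 // (lt_le_trans ltr01).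
have dr1 : d / r%:R <= 1.
  by rewrite ler_pdivrMr ?(lt_le_trans ltr01) // mul1r (le_trans (ltW d1)).
have ldr : 0 <= - ln (d / r%:R) by rewrite oppr_ge0 ln_le0.
pose del := eps / 2 / (1 - ln (d / r%:R)).
have del0 : 0 < del by rewrite divr_gt0 //; lra.
have [N [Q [QN hQ]]] := rv_approx del0 rp.
have rQ : rv Q by exact: rv_local QN.
exists N => n.
have -> : join_entropy mu P n = ent mu (fun x => [ffun k : 'I_n => p (sh k%:Z x)]).
  apply: eq_bigr => c _; congr eta_fn; rewrite /law /pr; congr (fine (mu _)).
  apply/seteqP; split => x /=.
    move=> h; apply/ffunP => k; rewrite ffunE; apply: val_inj.
    by apply/pE; have := h k; rewrite iter_shiftE.
  by move=> <- k; rewrite iter_shiftE ffunE; apply/pE.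
apply: le_trans (ent_name_le n d01 rp QN) _; rewrite lerD2l ler_wpM2l //.
have mpQ : measurable [set x : OmegaM e0 | p x != Q x].
  exact: (rv_measurable [set t : 'I_r * 'I_r | t.1 != t.2] (rv_pair rp rQ)).
have bI := @bmeas_indic _ _ R _ mpQ.
apply: (@le_trans _ _ (Ex mu (fun x => eps / 2 +
    (1 - ln (d / r%:R)) * \1_[set x : OmegaM e0 | p x != Q x] x))).
  apply: Ex_le.
  - exact: (bmeas_rv (fun t => - ln (kappa d t.1 t.2)) (rv_pair rp rQ)).
  - by apply: bmeasD; [exact: bmeas_cst|exact: bmeasZ].
  - move=> x; rewrite indicE /kappa; case: (eqVneq (p x) (Q x)) => [pQ|pQ].
      have -> : (x \in [set x : OmegaM e0 | p x != Q x]) = false.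
        by apply/memNset => /=; rewrite pQ eqxx.
      rewrite mulr0 addr0 mulr1.
      have -> : eps / 2 = - ln (1 - d) by rewrite /d subKr expRK opprK.
      rewrite lerN2 ler_ln ?posrE ?lerDl ?(ltW dr0) //; first by rewrite subr_gt0.
      by rewrite addr_gt0 // subr_gt0.
    by rewrite mem_set //= mulr0 add0r mulr1; lra.
rewrite ExD ?Ex_cst; [|exact: bmeas_cst|exact: bmeasZ].
rewrite ExZ // Ex_indic //.
have c0 : 0 < 1 - ln (d / r%:R) by lra.
have : (1 - ln (d / r%:R)) * pr mu [set x : OmegaM e0 | p x != Q x] <=
       (1 - ln (d / r%:R)) * del by rewrite ler_pM2l // ltW.
have -> : (1 - ln (d / r%:R)) * del = eps / 2 by rewrite /del mulrC divfK // gt_eqF.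
by lra.
Qed.

Lemma entropy_part_le_block (P : seq (set (OmegaM e0))) (eps : R) : 0 < eps ->
  is_partition P -> exists n0, forall n, (n0 <= n)%N ->
    n%:R * (entropy_part mu P - eps) <= block_ent mu n.
Proof.
move=> eps0 hP; have e3 : 0 < eps / 3 by rewrite divr_gt0.
have [N hN] := join_entropy_le e3 hP.
set l := entropy_part mu P.
have [cv|ncv] := pselect (cvgn (fun n => join_entropy mu P n / n%:R : R)); last first.
  (* Without convergence [limn] returns the default $0$, and nonnegativity of block entropy
     suffices. *)
  have -> : l = 0 by rewrite /l /entropy_part (dvgP ncv).
  exists 0%N => n _; apply: le_trans (block_ent_ge0 mu n).
  by rewrite sub0r mulrN oppr_le0 mulr_ge0 // ltW.
have /cvgrPdist_le /(_ _ e3) [n1 _ h1] : (fun n => join_entropy mu P n / n%:R) @ \oo --> l by [].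
have [n2 h2] := eventually_le_linear (2 * N%:R * `|l - eps|) e3.
exists (maxn (maxn n1 n2) 1 + 2 * N)%N => n' hn'.
have -> : n' = ((n' - 2 * N) + 2 * N)%N by lia.
set n := (n' - 2 * N)%N.
have nn1 : (n1 <= n)%N by lia.
have nn2 : (n2 <= n)%N by lia.
have n0 : (0 < n)%N by lia.
have n0R : 0 < n%:R :> R by rewrite ltr0n.
have := hN n; have := h1 n nn1 => /=; rewrite ler_norml => /andP[_ a1] a2.
have {}a1 : n%:R * (l - eps / 3) <= join_entropy mu P n.
  rewrite -ler_pdivlMl // mulrC; lra.
have a3 := h2 n nn2.
have a4 : 2 * N%:R * (l - eps) <= 2 * N%:R * `|l - eps|.
  by rewrite ler_wpM2l ?ler_norm // mulr_ge0.
rewrite natrD natrM mulrDl; lra.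
Qed.

Lemma KS_entropy_fin : KS_entropy mu \is a fin_num.
Proof.
rewrite fin_numE; apply/andP; split.
  apply/eqP => h.
  have : ((entropy_part mu [:: setT])%:E <= KS_entropy mu)%E.
    apply: ereal_sup_ubound; exists [:: setT] => //; split; first by move=> [|[]] // _; exact: measurableT.
    split; first by move=> [|i] [|j].
    by move=> x; exists 0%N.
  by rewrite h.
have : (KS_entropy mu <= (ln #|E|%:R + 1)%:E)%E.
  apply: ub_ereal_sup => _ [P hP <-]; rewrite lee_fin.
  have [n0 h0] := entropy_part_le_block ltr01 hP.
  have := le_trans (h0 n0.+1 (leqW (leqnn _))) (block_ent_le mu _).
  by rewrite ler_pM2l ?ltr0n // lerBlDr.
by move=> h; apply/eqP => h'; rewrite h' in h.
Qed.

(** A partition nearly attaining the supremum, itself controlled by [entropy_part_le_block], gives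
    the upper half of the generator theorem. *)
Lemma KS_entropy_le_block (eps : R) : 0 < eps -> exists n0, forall n, (n0 <= n)%N ->
  n%:R * (fine (KS_entropy mu) - eps) <= block_ent mu n.
Proof.
move=> eps0; have e2 : 0 < eps / 2 by rewrite divr_gt0.
have [_ [P hP <-] hl] := ub_ereal_sup_adherent e2 KS_entropy_fin.
have [n0 h0] := entropy_part_le_block e2 hP; exists n0 => n /h0; apply: le_trans.
rewrite ler_wpM2l //; move: hl; rewrite -/(KS_entropy mu) -(fineK KS_entropy_fin).
by rewrite -EFinB lte_fin fineK ?KS_entropy_fin // => ?; lra.
Qed.

End KolmogorovSinai.

(** * Partition functions with frozen boundary and the topological pressure *)

Section Pressure.
Context {E : finType} {e0 : E} {R : realType}.
Variable phi : Omega e0 -> R.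
Hypothesis phiu : ucont phi.
Implicit Types x y z w : Omega e0.

Lemma omega_dist_ge1 x y : x 0 != y 0 -> 1 <= omega_dist R x y.
Proof.
move=> xy; apply: ub_le_sup; last by right; exists 0; rewrite expr0 invr1.
exists 1 => _ [->|[k [_ ->]]] //.
by rewrite invf_le1 ?exprn_gt0 // exprn_ege1 // ler1n.
Qed.

Lemma omega_dist_le K x y : agree K x y -> omega_dist R x y <= 2%:R ^- K.
Proof.
move=> xy; apply: ge_sup; first by exists 0; left.
move=> _ [->|[k [xyk ->]]]; first by rewrite invr_ge0 exprn_ge0.
rewrite lef_pV2 ?posrE ?exprn_gt0 // ler_weXn2l ?ler1n //.
by rewrite leqNgt; apply/negP => kK; rewrite (xy k (ltnW kK)) eqxx in xyk.
Qed.

Lemma exists_pow2_le (eps : R) : 0 < eps -> exists K, 2%:R ^- K <= eps.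
Proof.
move=> eps0; exists (Num.trunc eps^-1).+1.
rewrite -[leRHS]invrK lef_pV2 ?posrE ?exprn_gt0 ?invr_gt0 //.
apply: (@le_trans _ _ (Num.trunc eps^-1).+1%:R); first exact/ltW/truncnS_gt.
by rewrite -natrX ler_nat ltnW // ltn_expl.
Qed.

Lemma mem_fset_of_seq (s : seq int) k : (k \in [fset i in s]%fset) = (k \in s).
Proof. by rewrite inE. Qed.

(** With $2^{-K}\le\varepsilon$, points of a separated family are told apart by their words on
    $[-K,n+K]$. Finiteness makes the supremum in [Zn] genuine. *)
Lemma separated_size n (eps : R) : 0 < eps ->
  exists C : nat, forall F : seq (Omega e0), Defs.separated n eps F -> (size F <= C)%N.
Proof.
move=> /exists_pow2_le [K hK].
pose s : seq int := [seq i%:Z - K%:Z | i <- iota 0 (n + 2 * K).+1].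
pose W : {fset int} := [fset x in s]%fset.
exists #|{ffun W -> E}| => F sF.
have uF : uniq [seq restr W x | x <- F].
  apply/(uniqP (restr W (point : Omega e0))) => i j; rewrite !inE !size_map => iF jF.
  rewrite !(nth_map point) // => hij; apply/eqP/negP => /negP ij.
  have := sF _ _ iF jF ij; rewrite ltNge => /negP; apply.
  apply: bigmax_le; first by rewrite (le_trans _ hK) // invr_ge0 exprn_ge0.
  move=> k _; apply: le_trans hK; apply: omega_dist_le; rewrite !iter_shiftE => l lK.
  have ls : l + k%:Z \in s.
    apply/mapP; exists (absz (l + k%:Z + K%:Z)); last by lia.
    by rewrite mem_iota; have := ltn_ord k; lia.
  have lW : l + k%:Z \in W by rewrite mem_fset_of_seq.
  by move/ffunP: hij => /(_ [` lW]%fset); rewrite !ffunE.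
by rewrite -(size_map (restr W)) -(card_uniqP uF) max_card.
Qed.

Lemma birkhoff_bounded : exists2 B : R, 0 < B &
  forall n x, `|birkhoff phi n x| <= n%:R * B.
Proof.
have [B B0 hB] := ucont_bounded phiu; exists B => // n x.
have := @norm_sum_small R (fun k => phi (sh k%:Z x)) n 0 B B.
by rewrite birkhoffE mul0r addr0; apply => //; exact: ltW.
Qed.

Definition sep_sums n (eps : R) := [set s : R | exists F : seq (Omega e0),
  Defs.separated n eps F /\ s = \sum_(x <- F) expR (birkhoff phi n x)].

Lemma sep_sums_has_sup n (eps : R) : 0 < eps -> has_sup (sep_sums n eps).
Proof.
move=> eps0; split; first by exists 0, [::]; rewrite big_nil.
have [C hC] := separated_size n eps0; have [B B0 hB] := birkhoff_bounded.
exists (C%:R * expR (n%:R * B)) => _ [F [/hC sF ->]].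
apply: (@le_trans _ _ (\sum_(x <- F) expR (n%:R * B))).
  apply: ler_sum => x _; rewrite ler_expR (le_trans (ler_norm _)) //.
rewrite big_const_seq count_predT iter_addr_0 -[_ *+ size F]mulr_natl.
by rewrite ler_wpM2r ?expR_ge0 // ler_nat.
Qed.

Definition Zfix n w : R :=
  \sum_(xi : {ffun Iset n -> E}) expR (birkhoff phi n (glue xi w)).

Lemma Zfix_gt0 n w : 0 < Zfix n w. Proof. exact: sum_expR_gt0. Qed.

Lemma Zfix_le_Zn n w (eps : R) : 0 < eps < 1 -> Zfix n w <= Zn phi n eps.
Proof.
(* Two different words on the block disagree at some site of it; shifting that site to the origin
   gives distance at least $1$, so the glued configurations are separated. *)
move=> /andP[eps0 eps1].
apply: (sup_upper_bound (sep_sums_has_sup n eps0)).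
exists [seq glue xi w | xi <- index_enum {ffun Iset n -> E}]; split; last by rewrite big_map.
move=> i j; rewrite size_map => iF jF ij.
rewrite !(nth_map [ffun => e0]) //.
set xi := nth _ _ i; set xj := nth _ _ j.
have : xi != xj by rewrite nth_uniq ?index_enum_uniq.
move=> /eqP h.
have [s xs] : exists s, xi s != xj s.
  apply: contrapT => h'; apply: h; apply/ffunP => s; apply/eqP; apply: contrapT => /negP hs.
  by apply: h'; exists s.
have := valP s; rewrite mem_Iset => /andP[s0 sn].
have kn : (`|val s| < n)%N by lia.
apply: (lt_le_trans eps1).
apply: (bigmax_sup (Ordinal kn)) => //.
apply: omega_dist_ge1; rewrite !iter_shiftE /sh /= add0r.
have -> : (`|val s|%N)%:Z = val s by lia.
by rewrite !glue_val.
Qed.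

Lemma Zn_le n (eps eps' : R) : 0 < eps -> eps <= eps' -> Zn phi n eps' <= Zn phi n eps.
Proof.
move=> eps0 le; apply: sup_le.
- move=> s [F [sF sE]]; exists s; split => //; exists F; split => // i j iF jF ij.
  exact: le_lt_trans le (sF i j iF jF ij).
- by exists 0, [::]; rewrite big_nil.
- exact: sep_sums_has_sup.
Qed.

Lemma limn_esup_le (u v : nat -> \bar R) : (forall n, (u n <= v n)%E) ->
  (limn_esup u <= limn_esup v)%E.
Proof.
move=> uv; rewrite !limn_esup_lim; apply: lee_lim; [exact: is_cvg_esups..|].
apply: nearW => n; apply: ub_ereal_sup => _ [k nk <-].
by apply: le_trans (uv k) _; apply: ereal_sup_ubound; exists k.
Qed.

(** [pressure_eps] grows as [eps] decreases, so its limit at $0^+$ is a supremum over $(0,1)$,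
    bounded below by the value at $1/2$; there [Zfix_le_Zn] applies. *)
Lemma pressure_ge w :
  (limn_esup (fun n => (ln (Zfix n w) / n%:R)%:E) <= pressure phi)%E.
Proof.
have mono : {in `]0, 1[ &, {homo pressure_eps phi : a b / a <= b >-> (b <= a)%E}}.
  move=> a b; rewrite !in_itv /= => /andP[a0 a1] /andP[b0 b1] ab.
  apply: limn_esup_le => n; rewrite lee_fin ler_wpM2r ?invr_ge0 // ler_ln ?posrE.
  - exact: Zn_le.
  - by apply: lt_le_trans (Zfix_gt0 n w) _; apply: Zfix_le_Zn; rewrite b0.
  - by apply: lt_le_trans (Zfix_gt0 n w) _; apply: Zfix_le_Zn; rewrite a0.
have lt01 : (BRight (0 : R) < BLeft 1)%O by rewrite bnd_simp.
have := nonincreasing_at_right_cvge (BLeft 1) lt01 mono.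
rewrite /pressure => /cvg_lim -> //.
have h12 : 0 < 2^-1 :> R by rewrite invr_gt0.
have h12' : 2^-1 < 1 :> R by rewrite invf_lt1 // ltr1n.
apply: (@le_trans _ _ (pressure_eps phi 2^-1)).
  apply: limn_esup_le => n; rewrite lee_fin ler_wpM2r ?invr_ge0 // ler_ln ?posrE.
  - by apply: Zfix_le_Zn; rewrite h12.
  - exact: Zfix_gt0.
  - by apply: lt_le_trans (Zfix_gt0 n w) _; apply: Zfix_le_Zn; rewrite h12.
by apply: ereal_sup_ubound; exists 2^-1 => //=; rewrite in_itv /= h12.
Qed.

Lemma ln_Zfix_le w (p : R) : pressure phi = p%:E -> forall eps : R, 0 < eps ->
  exists n0, forall n, (n0 <= n)%N -> ln (Zfix n w) <= n%:R * (p + eps).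
Proof.
move=> hp eps eps0; have := pressure_ge w; rewrite hp limn_esup_lim.
rewrite (cvg_lim _ (@cvg_esups_inf _ _)) // => h.
have : (ereal_inf (range (esups (fun n => (ln (Zfix n w) / n%:R)%:E))) < (p + eps)%:E)%E.
  by apply: le_lt_trans h _; rewrite lte_fin ltrDl.
move=> /ereal_inf_lt [_ [m _ <-] hm].
exists m.+1 => n mn; rewrite -ler_pdivrMl ?ltr0n; last lia.
rewrite mulrC -lee_fin; apply: le_trans (ltW hm).
by apply: ereal_sup_ubound; exists n => //=; lia.
Qed.

End Pressure.

(** * Shift covariance of the kernels and products over disjoint windows *)

Section ShiftCovariance.
Context {E : finType} {e0 : E} {R : realType}.
Variable phi : Omega e0 -> R.
Hypotheses (phiu : ucont phi) (phie : extensible phi).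
Implicit Types x y z w : Omega e0.

(** Translation is a bijection between words on [D] and on [L], and it preserves the weights since
    [Delta] is shift-invariant. *)
Lemma spec_apply_sh (k : nat) (L D : {fset int}) (f : Omega e0 -> R) x :
  (forall i, (i \in D) = (i - k%:Z \in L)) ->
  spec_apply (gibbs_spec phi) D (f \o sh k%:Z) x =
  spec_apply (gibbs_spec phi) L f (sh k%:Z x).
Proof.
move=> DL.
pose a (xi : {ffun L -> E}) : {ffun D -> E} := restr D (sh (- k%:Z) (glue xi (sh k%:Z x))).
pose b (zeta : {ffun D -> E}) : {ffun L -> E} := restr L (sh k%:Z (glue zeta x)).
have shK y : sh k%:Z (sh (- k%:Z) y) = y by rewrite sh_sh subrr sh0.
have shK' y : sh (- k%:Z) (sh k%:Z y) = y by rewrite sh_sh addNr sh0.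
have aE xi : glue (a xi) x = sh (- k%:Z) (glue xi (sh k%:Z x)).
  rewrite /a glue_restr // => i; rewrite DL => iL.
  by rewrite {1}/sh glue_notin // /sh subrK.
have bE zeta : glue (b zeta) (sh k%:Z x) = sh k%:Z (glue zeta x).
  rewrite /b glue_restr // => i iL; rewrite /sh glue_notin // DL.
  by rewrite addrK.
have abK : cancel b a by move=> zeta; rewrite /a bE shK' restr_glue.
have baK : cancel a b by move=> xi; rewrite /b aE shK restr_glue.
have ba : bijective a by exists b.
have DE xi : Delta phi (glue (a xi) x) x = Delta phi (glue xi (sh k%:Z x)) (sh k%:Z x).
  rewrite -(Delta_shn phiu phie k (@glue_eqoff _ _ _ (a xi) x)).
  by rewrite aE shK.
have ZE : \sum_(eta : {ffun D -> E}) expR (Delta phi (glue eta x) x) =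
    \sum_(eta : {ffun L -> E}) expR (Delta phi (glue eta (sh k%:Z x)) (sh k%:Z x)).
  by rewrite (reindex a) /=; [apply: eq_bigr => xi _; rewrite DE|exact: onW_bij].
rewrite /spec_apply (reindex a) /=; last exact: onW_bij.
by apply: eq_bigr => xi _; rewrite /gibbs_spec ZE DE aE shK.
Qed.

Lemma spec_apply_le (L : {fset int}) (f g : Omega e0 -> R) x :
  (forall y, f y <= g y) ->
  spec_apply (gibbs_spec phi) L f x <= spec_apply (gibbs_spec phi) L g x.
Proof.
move=> fg; apply: ler_sum => xi _; rewrite ler_wpM2l //.
exact/ltW/gibbs_spec_gt0.
Qed.

Lemma spec_applyD (L : {fset int}) (f g : Omega e0 -> R) x :
  spec_apply (gibbs_spec phi) L (fun y => f y + g y) x =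
  spec_apply (gibbs_spec phi) L f x + spec_apply (gibbs_spec phi) L g x.
Proof. by rewrite /spec_apply -big_split /=; apply: eq_bigr => xi _; rewrite mulrDr. Qed.

Lemma spec_applyZ (L : {fset int}) c (f : Omega e0 -> R) x :
  spec_apply (gibbs_spec phi) L (fun y => c * f y) x = c * spec_apply (gibbs_spec phi) L f x.
Proof. by rewrite /spec_apply mulr_sumr; apply: eq_bigr => xi _; rewrite mulrCA. Qed.

Lemma spec_apply_cst (L : {fset int}) c x :
  spec_apply (gibbs_spec phi) L (fun=> c) x = c.
Proof. by rewrite /spec_apply -mulr_suml gibbs_spec_sum1 // mul1r. Qed.

(** By consistency one may first average over the translate [D] of [L] in the last window. The
    earlier factors do not see [D], and the last one averages to at most [c] whatever the boundary
    condition. *)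
Lemma spec_apply_prod (m N : nat) (L : {fset int}) (g : Omega e0 -> R) (c : R) w :
  (forall x, 0 <= g x) -> (forall x y, agree N x y -> g x = g y) ->
  (forall l, l \in L -> (`|l| <= N)%N) ->
  (forall x, spec_apply (gibbs_spec phi) L g x <= c) ->
  forall j, (j <= m)%N ->
  spec_apply (gibbs_spec phi) (Iset (m * (2 * N).+1))
    (fun x => \prod_(i < j) g (sh (i * (2 * N).+1 + N)%N%:Z x)) w <= c ^+ j.
Proof.
move=> g0 gN LN gc; set M := (2 * N).+1; elim=> [|j IH] jm.
  rewrite expr0 (_ : (fun x => _) = (fun=> 1)) ?spec_apply_cst //.
  by apply/funext => x; rewrite big_ord0.
set kj := (j * M + N)%N.
pose D : {fset int} := [fset (l + kj%:Z)%R | l in L]%fset.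
have DL i : (i \in D) = (i - kj%:Z \in L).
  apply/imfsetP/idP => [[l /= lL ->]|h]; first by rewrite addrK.
  by exists (i - kj%:Z) => //; rewrite subrK.
have jM : ((j * M)%N + M <= m * M)%N by rewrite -mulSnr leq_mul2r jm orbT.
have sub : (D `<=` Iset (m * M))%fset.
  apply/fsubsetP => i; rewrite DL => /LN h; rewrite mem_Iset.
  by apply/andP; split; rewrite /M /kj in jM h *; lia.
rewrite -(gibbs_spec_consistent phiu phie _ _ sub).
pose P x := \prod_(i < j) g (sh (i * M + N)%N%:Z x).
have P0 x : 0 <= P x by apply: prodr_ge0.
have indep x (zeta : {ffun D -> E}) : P (glue zeta x) = P x.
  apply: eq_bigr => i _; apply: gN => l lN; rewrite /sh glue_notin //.
  rewrite DL; apply/negP => /LN.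
  have : ((i * M)%N + M <= j * M)%N by rewrite -mulSnr leq_mul2r (ltn_ord i) orbT.
  by rewrite /kj /M; lia.
apply: (@le_trans _ _ (spec_apply (gibbs_spec phi) (Iset (m * M)) (fun x => c * P x) w)).
  apply: spec_apply_le => x.
  rewrite (_ : (fun x => _) = (fun x => P x * (g \o sh kj%:Z) x)); last first.
    by apply/funext => y; rewrite big_ord_recr.
  rewrite (@spec_apply_indep _ _ _ phi D P _ x (indep x)).
  by rewrite (spec_apply_sh _ _ DL) mulrC ler_wpM2r.
rewrite spec_applyZ exprS; have c0 : 0 <= c.
  by apply: le_trans (gc w); apply: sumr_ge0 => xi _; rewrite mulr_ge0 // ltW // gibbs_spec_gt0.
by rewrite ler_wpM2l // IH // ltnW.
Qed.

End ShiftCovariance.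

(** * Equilibrium states: DLR equations and weak Bowen-Gibbs bounds *)

Section Equilibrium.
Context {E : finType} {e0 : E} {R : realType}.
Variable phi : Omega e0 -> R.
Hypotheses (phiu : ucont phi) (phie : extensible phi).
Variable mu : probability (OmegaM e0) R.
Hypothesis mu_eq : equilibrium_state phi mu.
Implicit Types x y z w : Omega e0.

Let mu_inv : shift_invariant mu := proj1 mu_eq.
Let w0 : Omega e0 := fun=> e0.
Let p : R := fine (KS_entropy mu) + Ex mu phi.

Lemma pressureE : pressure phi = p%:E.
Proof.
case: mu_eq => _ <-; rewrite (Ex_EFin mu (ucont_bmeas phiu)).
by rewrite -(fineK (KS_entropy_fin mu_inv)).
Qed.

Lemma Ex_birkhoff n : Ex mu (birkhoff phi n) = n%:R * Ex mu phi.
Proof.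
have bphi := ucont_bmeas phiu.
rewrite (_ : birkhoff phi n = fun x => \sum_(0 <= k < n) (phi \o sh k%:Z) x).
  rewrite Ex_sum => [|k]; last exact: bmeas_sh.
  under eq_bigr do rewrite Ex_sh //.
  by rewrite sumr_const_nat subn0 mulr_natl.
by apply/funext => x; rewrite birkhoffE.
Qed.

Lemma bmeas_birkhoff n : bmeas (birkhoff phi n).
Proof.
apply: ucont_bmeas; apply: ucont_sum => k _.
by apply: (eq_ucont _ (ucont_sh k%:Z phiu)) => x /=; rewrite iter_shiftE.
Qed.

Lemma Ex_birkhoff_glue (eps : R) : 0 < eps -> exists n0, forall n, (n0 <= n)%N ->
  n%:R * (Ex mu phi - eps) <=
  Ex mu (fun x => birkhoff phi n (glue (restr (Iset n) x) w0)).
Proof.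
move=> /(birkhoff_variation phiu) [n0 h0]; exists n0 => n /h0 hn.
rewrite mulrBr -Ex_birkhoff -[X in _ - X](Ex_cst mu) -mulN1r -ExZ; last exact: bmeas_cst.
rewrite -ExD; [|exact: bmeas_birkhoff|by apply: bmeasZ; exact: bmeas_cst].
apply: Ex_le.
- by apply: bmeasD; [exact: bmeas_birkhoff|apply: bmeasZ; exact: bmeas_cst].
- exact: (bmeas_rv (fun xi => birkhoff phi n (glue xi w0)) (@rv_restr _ _ (Iset n))).
- move=> x; have := hn x (glue (restr (Iset n) x) w0).
  rewrite ler_norml => /(_ _) /andP[]; first by move=> k kn; rewrite glue_Iset //; lia.
  by rewrite mulN1r; lra.
Qed.

(** The variational inequality with energy $S_n\phi$: block entropy and mean energy already
    contribute $n(p-\varepsilon)$. *)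
Lemma ln_Zfix_ge (eps : R) : 0 < eps -> exists n0, forall n, (n0 <= n)%N ->
  n%:R * (p - eps) <= ln (Zfix phi n w0).
Proof.
move=> eps0; have e2 : 0 < eps / 2 by rewrite divr_gt0.
have [n1 h1] := Ex_birkhoff_glue e2; have [n2 h2] := KS_entropy_le_block mu_inv e2.
exists (maxn n1 n2) => n; rewrite geq_max => /andP[/h1 {}h1 /h2 {}h2].
apply: le_trans (ent_variational mu (fun xi => birkhoff phi n (glue xi w0))
  (@rv_restr _ _ (Iset n))).
apply: le_trans (lerD h2 h1); rewrite /p -mulrDr ler_wpM2l //; lra.
Qed.

(* Perturb the finite-volume Gibbs weights by independent copies of [g] placed in *)
(* disjoint windows: the partition function grows by at most [(1 + d)^m], while   *)
(* the energy grows by [m] times the mean of [ln g]; equilibrium forbids a gain.  *)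
Lemma Ex_ln_le (N : nat) (L : {fset int}) (g : Omega e0 -> R) (d : R) : 0 <= d ->
  (forall x, 0 < g x) -> (forall x y, agree N x y -> g x = g y) ->
  (forall l, l \in L -> (`|l| <= N)%N) ->
  (forall x, spec_apply (gibbs_spec phi) L g x <= 1 + d) ->
  Ex mu (fun x => ln (g x)) <= ln (1 + d).
Proof.
move=> d0 g0 gN LN gd; set M := (2 * N).+1.
have M0 : 0 < M%:R :> R by rewrite ltr0n.
apply/ler_addgt0Pr => e e_gt0.
(* Five errors of size [n * eps] occur: entropy, mean energy, pressure, and [Delta_birkhoff] twice.
   With $n=mM$ they add up to [m * e]. *)
pose eps := e / (5 * M%:R).
have eps0 : 0 < eps by rewrite divr_gt0 // mulr_gt0.
have [n1 h1] := Ex_birkhoff_glue eps0; have [n2 h2] := KS_entropy_le_block mu_inv eps0.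
have [n3 h3] := ln_Zfix_le phiu w0 pressureE eps0.
have [n4 h4] := Delta_birkhoff phiu phie eps0.
pose m := (n1 + n2 + n3 + n4).+1.
pose n := (m * M)%N.
have mn : (m <= n)%N by rewrite /n leq_pmulr.
have {}h1 := h1 n ltac:(lia); have {}h2 := h2 n ltac:(lia).
have {}h3 := h3 n ltac:(lia); have {}h4 := h4 n ltac:(lia).
have eqoffn (xi : {ffun Iset n -> E}) : eqoff (irange n) (glue xi w0) w0.
  by apply: eqoff_Iset; exact: glue_eqoff.
pose G x := \prod_(i < m) g (sh (i * M + N)%N%:Z x).
have G0 x : 0 < G x by apply: prodr_gt0.
(* The logarithm of the perturbed weight, to be used as the energy in [ent_variational]. *)
pose F (xi : {ffun Iset n -> E}) := Delta phi (glue xi w0) w0 + ln (G (glue xi w0)).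
pose Z := \sum_(xi : {ffun Iset n -> E}) expR (Delta phi (glue xi w0) w0).
have Z0 : 0 < Z by exact: sum_expR_gt0.
have hF : \sum_xi expR (F xi) <= Z * (1 + d) ^+ m.
  rewrite (eq_bigr (fun xi => expR (Delta phi (glue xi w0) w0) * G (glue xi w0))); last first.
    by move=> xi _; rewrite expRD lnK // posrE.
  have hp : spec_apply (gibbs_spec phi) (Iset n) G w0 <= (1 + d) ^+ m.
    exact: (spec_apply_prod phiu phie w0 (fun x => ltW (g0 x)) gN LN gd (leqnn m)).
  rewrite mulrC -ler_pdivrMr //; apply: le_trans hp.
  rewrite mulr_suml; apply: ler_sum => xi _.
  by rewrite /gibbs_spec mulrAC.
have hZ : Z <= expR (n%:R * eps - birkhoff phi n w0) * Zfix phi n w0.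
  rewrite /Zfix mulr_sumr; apply: ler_sum => xi _; rewrite -expRD ler_expR.
  by have := h4 _ _ (eqoffn xi); rewrite ler_norml => /andP[_]; lra.
have lnF : ln (\sum_xi expR (F xi)) <=
    n%:R * eps - birkhoff phi n w0 + n%:R * (p + eps) + m%:R * ln (1 + d).
  have d1 : 0 < 1 + d by rewrite ltr_wpDr.
  apply: (@le_trans _ _ (ln (expR (n%:R * eps - birkhoff phi n w0) * Zfix phi n w0
      * (1 + d) ^+ m))).
    rewrite ler_ln ?posrE ?sum_expR_gt0 //.
      by apply: le_trans hF _; rewrite ler_wpM2r // exprn_ge0 // ltW.
    by rewrite !mulr_gt0 ?expR_gt0 ?exprn_gt0 // Zfix_gt0.
  rewrite lnM ?posrE ?exprn_gt0 ?mulr_gt0 ?expR_gt0 ?Zfix_gt0 //.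
  rewrite lnM ?posrE ?expR_gt0 ?Zfix_gt0 // expRK lnXn // -[_ *+ m]mulr_natl.
  by rewrite lerD2r lerD2l.
have bx (f : {ffun Iset n -> E} -> R) : bmeas (fun x => f (restr (Iset n) x)).
  exact: (bmeas_rv f (@rv_restr _ _ (Iset n))).
have bg : bmeas (fun x => ln (g x)).
  apply: ucont_bmeas => e' e'0; exists N => x y /gN ->.
  by rewrite subrr normr0 ltW.
have EF : n%:R * (Ex mu phi - eps) - birkhoff phi n w0 - n%:R * eps
    + m%:R * Ex mu (fun x => ln (g x)) <= Ex mu (fun x => F (restr (Iset n) x)).
  rewrite /F ExD; [|exact: (bx (fun xi => Delta phi (glue xi w0) w0))
                   |exact: (bx (fun xi => ln (G (glue xi w0))))].
  apply: lerD.
    have e1 : Ex mu (fun x => birkhoff phi n (glue (restr (Iset n) x) w0) +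
        (- birkhoff phi n w0 - n%:R * eps)) <=
        Ex mu (fun x => Delta phi (glue (restr (Iset n) x) w0) w0).
      apply: Ex_le.
      - exact: (bx (fun xi => birkhoff phi n (glue xi w0) + (- birkhoff phi n w0 - n%:R * eps))).
      - exact: (bx (fun xi => Delta phi (glue xi w0) w0)).
      - move=> x; have := h4 _ _ (eqoffn (restr (Iset n) x)).
        by rewrite ler_norml => /andP[+ _]; lra.
    apply: le_trans e1; rewrite ExD ?Ex_cst; [lra| |exact: bmeas_cst].
    exact: (bx (fun xi => birkhoff phi n (glue xi w0))).
  rewrite (_ : (fun x => ln (G _)) =
      (fun x => \sum_(i < m) ((fun x => ln (g x)) \o sh (i * M + N)%N%:Z) x)).
    rewrite Ex_sum => [|i]; last exact: (bmeas_sh (i * M + N)%N%:Z bg).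
    rewrite (eq_bigr (fun=> Ex mu (fun x => ln (g x)))) => [|i _];
      last exact: (Ex_sh mu_inv (i * M + N)%N bg).
    by rewrite sumr_const card_ord mulr_natl.
  apply/funext => x; rewrite /G ln_prod //; apply: eq_bigr => i _ /=.
  congr ln; apply: gN => l lN; rewrite /sh.
  have : ((i * M)%N + M <= n)%N by rewrite -mulSnr leq_mul2r (ltn_ord i) orbT.
  by rewrite /M => ?; rewrite glue_Iset //; lia.
have := ent_variational mu F (@rv_restr _ _ (Iset n)); rewrite -/(block_ent mu n) => hv.
have m0 : 0 < m%:R :> R by rewrite ltr0n.
have ne : n%:R * eps * 5 = m%:R * e.
  by rewrite /n natrM /eps; field; rewrite gt_eqF.
rewrite -(ler_pM2l m0) mulrDr -ne; move: h2 EF lnF hv; rewrite /p; lra.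
Qed.

(** Composing with [cut N] turns a continuous function into a local one that is uniformly close to
    it for large [N]. *)
Definition cut (N : nat) x : Omega e0 := fun k => if (`|k| <= N)%N then x k else e0.

(** A positive mean of [u] would make the mean of $\ln(1+tu)$ positive to first order in [t], while
    [Ex_ln_le] leaves only the small error from making [u] local. *)
Lemma Ex_centered_le0 (L : {fset int}) (u : Omega e0 -> R) : ucont u ->
  (forall x, spec_apply (gibbs_spec phi) L u x = 0) -> Ex mu u <= 0.
Proof.
move=> uu u0; rewrite leNgt; apply/negP => c0; set c := Ex mu u in c0.
have [B B0 hB] := ucont_bounded uu.
(* The first bound keeps $|t\,u|\le1/2$, as [ln1D_ge] asks; the second makes its quadratic error at
   most $tc/4$. *)
pose t := Num.min (1 / (2 * B)) (c / (8 * B ^+ 2)).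
have t0 : 0 < t by rewrite lt_min !divr_gt0 // ?mulr_gt0 ?exprn_gt0.
have tB : t * B <= 1 / 2.
  have : t <= 1 / (2 * B) by rewrite ge_min lexx.
  move=> /(ler_wpM2r (ltW B0)) /le_trans; apply.
  by have -> : 1 / (2 * B) * B = 1 / 2 by field; rewrite gt_eqF.
have tB2 : t * B ^+ 2 <= c / 8.
  have : t <= c / (8 * B ^+ 2) by rewrite ge_min lexx orbT.
  move=> /(ler_wpM2r (ltW (exprn_gt0 2 B0))) /le_trans; apply.
  by have -> : c / (8 * B ^+ 2) * B ^+ 2 = c / 8 by field; rewrite gt_eqF.
have eta0 : 0 < c / 8 by rewrite divr_gt0.
have [N1 hN1] := uu _ eta0; have [N2 hN2] := seq_int_bounded L.
set N := maxn N1 N2.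
pose uN x := u (cut N x).
have uNu x : `|uN x - u x| <= c / 8.
  apply: hN1; apply: (@agree_le _ _ _ N); first exact: leq_maxl.
  by move=> k kN; rewrite /cut kN.
have uNloc x y : agree N x y -> uN x = uN y.
  move=> xy; rewrite /uN; congr u; apply/funext => k; rewrite /cut.
  by case: ifP => // /xy.
have tuN x : `|t * uN x| <= 1 / 2.
  by rewrite normrM (gtr0_norm t0) (le_trans _ tB) // ler_pM2l //; exact: hB.
pose g x := 1 + t * uN x.
have g0 x : 0 < g x by have := tuN x; rewrite /g ler_norml => /andP[]; lra.
have LN l : l \in L -> (`|l| <= N)%N.
  by move=> /hN2 /leq_trans; apply; exact: leq_maxr.
have gs x : spec_apply (gibbs_spec phi) L g x <= 1 + t * (c / 8).
  rewrite /g spec_applyD spec_apply_cst lerD2l spec_applyZ ler_pM2l //.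
  have : spec_apply (gibbs_spec phi) L uN x <=
      spec_apply (gibbs_spec phi) L (fun y => u y + c / 8) x.
    apply: spec_apply_le => y; have := uNu y; rewrite ler_norml => /andP[_]; lra.
  by rewrite spec_applyD spec_apply_cst u0 add0r.
have gl : forall x y, agree N x y -> g x = g y by move=> x y /uNloc; rewrite /g => ->.
have d0 : 0 <= t * (c / 8) by rewrite mulr_ge0 // ltW.
have h1 := Ex_ln_le d0 g0 gl LN gs.
have h2 : ln (1 + t * (c / 8)) <= t * (c / 8).
  have := @ln_le_subr1 R (1 + t * (c / 8)); rewrite addrAC subrr add0r; apply; lra.
have bu := ucont_bmeas uu.
have buN : bmeas (fun x => ln (g x)).
  apply: ucont_bmeas => e' e'0; exists N => x y /gl ->.
  by rewrite subrr normr0 ltW.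
have h3 : Ex mu (fun x => t * u x + (- (t * (c / 8)) - t * (c / 4))) <= Ex mu (fun x => ln (g x)).
  apply: Ex_le => //; first by apply: bmeasD; [exact: bmeasZ|exact: bmeas_cst].
  move=> x; have := tuN x; rewrite ler_norml => /andP[l1 _].
  apply: le_trans (ln1D_ge l1).
  have a1 : t * u x - t * (c / 8) <= t * uN x.
    by rewrite -mulrBr ler_pM2l //; have := uNu x; rewrite ler_norml => /andP[+ _]; lra.
  have a2 : 2 * (t * uN x) ^+ 2 <= t * (c / 4).
    have b1 : uN x ^+ 2 <= B ^+ 2.
      rewrite -real_normK ?num_real // lerXn2r ?nnegrE ?(ltW B0) //; exact: hB.
    have : t * uN x ^+ 2 <= c / 8.
      by apply: le_trans tB2; rewrite ler_pM2l.
    rewrite -(ler_pM2l t0) exprMn expr2; lra.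
  lra.
rewrite ExD ?ExZ ?Ex_cst // in h3; [|exact: bmeasZ|exact: bmeas_cst].
(* The losses are $tc/8$ from localising, $tc/4$ from the quadratic term and $tc/8$ from the bound
   on $\ln(1+d)$, in total $tc/2$. *)
have : t * c <= t * (c / 2) by rewrite /c in h1 h2 h3 *; lra.
by rewrite ler_pM2l //; lra.
Qed.

(** The function $a(f-\gamma f)$ is centered because $\gamma_L\gamma_L=\gamma_L$; the signs $a=\pm1$
    give both inequalities. *)
Lemma Ex_spec_apply (L : {fset int}) (f : Omega e0 -> R) : ucont f ->
  Ex mu (spec_apply (gibbs_spec phi) L f) = Ex mu f.
Proof.
move=> fu; have su := spec_apply_ucont phiu phie L fu.
have fb := ucont_bmeas fu; have sb := ucont_bmeas su.
have key (a : R) : a * Ex mu f + (- a) * Ex mu (spec_apply (gibbs_spec phi) L f) <= 0.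
  rewrite -!ExZ // -ExD; [|exact: bmeasZ..].
  apply: (@Ex_centered_le0 L).
    by apply: ucontD; apply: ucontM => //; exact: ucont_cst.
  move=> x; rewrite spec_applyD !spec_applyZ gibbs_spec_consistent //.
  by rewrite mulNr subrr.
by have := key 1; have := key (-1); lra.
Qed.

Lemma equilibrium_gibbs : is_gibbs_for mu (gibbs_spec phi).
Proof.
move=> f /continuous_ucont fu L; have su := spec_apply_ucont phiu phie L fu.
by rewrite !Ex_EFin ?Ex_spec_apply //; exact: ucont_bmeas.
Qed.

Lemma pr_cyl n w : pr mu (cyl n w) =
  Ex mu (gibbs_spec phi (restr (Iset n) w)).
Proof.
pose f x : R := (restr (Iset n) x == restr (Iset n) w)%:R.
have fu : ucont f.
  move=> eps eps0; have [K hK] := seq_int_bounded (Iset n); exists K => x y xy.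
  have -> : f x = f y.
    congr ((_ == _)%:R); apply/ffunP => s; rewrite !ffunE xy //.
    by apply: hK; exact: valP.
  by rewrite subrr normr0 ltW.
transitivity (Ex mu f); last first.
  rewrite -(Ex_spec_apply (Iset n) fu); congr (Ex mu _); apply/funext => x.
  rewrite /spec_apply (bigD1 (restr (Iset n) w)) //= /f restr_glue eqxx mulr1.
  by rewrite big1 ?addr0 // => xi /negbTE h; rewrite restr_glue h mulr0.
rewrite (_ : cyl n w = restr (Iset n) @^-1` [set restr (Iset n) w]).
  rewrite (@Ex_rv _ _ _ mu _ (restr (Iset n) : OmegaM e0 -> _)
    (fun xi => (xi == restr (Iset n) w)%:R)); last exact: rv_restr.
  rewrite (bigD1 (restr (Iset n) w)) //= eqxx mulr1 big1 ?addr0 //.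
  by move=> xi /negbTE ->; rewrite mulr0.
apply/seteqP; split => x /=.
  move=> h; apply/ffunP => s; rewrite !ffunE.
  have := valP s; rewrite mem_Iset => /andP[s0 sn].
  have -> : val s = (absz (val s))%:Z by lia.
  by apply: h; lia.
move=> /ffunP h k kn.
have kI : k%:Z \in Iset n by rewrite mem_Iset; lia.
by have := h [` kI]%fset; rewrite !ffunE.
Qed.

(** The Birkhoff sum of the boundary condition [x] cancels between the weight and its normalisation,
    leaving the one of [w] and a partition function of size $e^{np+o(n)}$. *)
Lemma gibbs_spec_cyl (eps : R) : 0 < eps -> exists n0, forall n, (n0 <= n)%N ->
  forall w x, expR (birkhoff phi n w - n%:R * p - n%:R * eps) <=
    gibbs_spec phi (restr (Iset n) w) x <=
    expR (birkhoff phi n w - n%:R * p + n%:R * eps).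
Proof.
(* Two shares go to [dE] in the weight, one to [wE], and three to [ln S]: two from [dE] again and
   one from the growth of [Zfix]. *)
move=> eps0; have e6 : 0 < eps / 6 by rewrite divr_gt0.
have [n1 h1] := Delta_birkhoff phiu phie e6.
have [n2 h2] := birkhoff_variation phiu e6.
have [n3 h3] := ln_Zfix_le phiu w0 pressureE e6.
have [n4 h4] := ln_Zfix_ge e6.
exists (n1 + n2 + n3 + n4)%N => n hn w x.
have {}h1 := h1 n ltac:(lia); have {}h2 := h2 n ltac:(lia).
have {}h3 := h3 n ltac:(lia); have {}h4 := h4 n ltac:(lia).
have dE (xi : {ffun Iset n -> E}) : `|Delta phi (glue xi x) x -
    (birkhoff phi n (glue xi w0) - birkhoff phi n x)| <= n%:R * (2 * (eps / 6)).
  have := h1 _ _ (eqoff_Iset (@glue_eqoff _ _ _ xi x)).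
  have := h2 (glue xi x) (glue xi w0).
  rewrite !ler_norml => /(_ _) /andP[].
    move=> k kn; have kI : k%:Z \in Iset n by rewrite mem_Iset; lia.
    by rewrite -[k%:Z]/(val [` kI]%fset) !glue_val.
  move=> ? ? /andP[? ?]; apply/andP; split; lra.
have wE : `|birkhoff phi n (glue (restr (Iset n) w) w0) - birkhoff phi n w| <= n%:R * (eps / 6).
  by apply: h2 => k kn; rewrite glue_Iset //; lia.
set S := \sum_(eta : {ffun Iset n -> E}) expR (Delta phi (glue eta x) x).
have S0 : 0 < S by exact: sum_expR_gt0.
have Z0 := Zfix_gt0 phi n w0.
have S1 : ln S <= - birkhoff phi n x + n%:R * (2 * (eps / 6)) + ln (Zfix phi n w0).
  rewrite -[X in X + ln _]expRK -lnM ?posrE ?expR_gt0 // ler_ln ?posrE ?mulr_gt0 ?expR_gt0 //.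
  rewrite /Zfix mulr_sumr; apply: ler_sum => eta _; rewrite -expRD ler_expR.
  by have := dE eta; rewrite ler_norml => /andP[_]; lra.
have S2 : - birkhoff phi n x - n%:R * (2 * (eps / 6)) + ln (Zfix phi n w0) <= ln S.
  rewrite -[X in X + ln _]expRK -lnM ?posrE ?expR_gt0 // ler_ln ?posrE ?mulr_gt0 ?expR_gt0 //.
  rewrite /Zfix mulr_sumr; apply: ler_sum => eta _; rewrite -expRD ler_expR.
  by have := dE eta; rewrite ler_norml => /andP[+ _]; lra.
have -> : gibbs_spec phi (restr (Iset n) w) x =
    expR (Delta phi (glue (restr (Iset n) w) x) x - ln S).
  by rewrite expRD expRN lnK ?posrE.
rewrite !ler_expR; have := dE (restr (Iset n) w); move: wE; rewrite !ler_norml.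
by move=> /andP[? ?] /andP[? ?]; apply/andP; split; lra.
Qed.

Lemma pr_cyl_asymp (eps : R) : 0 < eps -> exists n0, forall n, (n0 <= n)%N ->
  forall w, `|ln (pr mu (cyl n w)) - (birkhoff phi n w - n%:R * p)| <= n%:R * eps.
Proof.
move=> /gibbs_spec_cyl [n0 h0]; exists n0 => n /h0 hn w.
have bg := ucont_bmeas (gibbs_spec_ucont phiu phie (restr (Iset n) w)).
have l1 : expR (birkhoff phi n w - n%:R * p - n%:R * eps) <= pr mu (cyl n w).
  rewrite pr_cyl -[leLHS](Ex_cst mu); apply: Ex_le => //; first exact: bmeas_cst.
  by move=> x; case/andP: (hn w x).
have l2 : pr mu (cyl n w) <= expR (birkhoff phi n w - n%:R * p + n%:R * eps).
  rewrite pr_cyl -[leRHS](Ex_cst mu); apply: Ex_le => //; first exact: bmeas_cst.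
  by move=> x; case/andP: (hn w x).
have p0 : 0 < pr mu (cyl n w) := lt_le_trans (expR_gt0 _) l1.
move: l1 l2; rewrite -{1 2}(lnK (x := pr mu (cyl n w))) ?posrE // !ler_expR ler_norml.
by move=> ? ?; apply/andP; split; lra.
Qed.

(** A crude bound for each fixed [n]: it makes logarithms of cylinder measures meaningful and the
    supremum over configurations finite, small [n] included. *)
Lemma pr_cyl_bounded n : exists2 c : R, 0 < c & forall w, c <= pr mu (cyl n w) <= 1.
Proof.
have [B B0 hB] := Delta_bounded phiu phie (Iset n).
pose K := #|{ffun Iset n -> E}|%:R * expR B.
have K0 : 0 < K.
  by rewrite mulr_gt0 ?expR_gt0 // ltr0n; apply/card_gt0P; exists [ffun => e0].
exists (expR (- B) / K) => [|w]; first by rewrite divr_gt0 // expR_gt0.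
have bg := ucont_bmeas (gibbs_spec_ucont phiu phie (restr (Iset n) w)).
have DB (xi : {ffun Iset n -> E}) x : `|Delta phi (glue xi x) x| <= B.
  by apply: hB; exact: glue_eqoff.
rewrite pr_cyl; apply/andP; split.
  rewrite -[leLHS](Ex_cst mu); apply: Ex_le => [||x] //; first exact: bmeas_cst.
  rewrite ler_pM ?expR_ge0 ?invr_ge0 ?(ltW K0) //.
    by rewrite ler_expR; have := DB (restr (Iset n) w) x; rewrite ler_norml => /andP[].
  rewrite lef_pV2 ?posrE ?sum_expR_gt0 // /K mulr_natl -sumr_const; apply: ler_sum => xi _.
  by rewrite ler_expR (le_trans (ler_norm _)).
rewrite -[leRHS](Ex_cst mu); apply: Ex_le => [||x] //; first exact: bmeas_cst.
rewrite -(gibbs_spec_sum1 phi (Iset n) x) (bigD1 (restr (Iset n) w)) //=.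
by rewrite lerDl sumr_ge0 // => xi _; exact/ltW/gibbs_spec_gt0.
Qed.

Lemma equilibrium_weak_bowen_gibbs : weak_bowen_gibbs mu phi.
Proof.
pose dev n w := `|ln (pr mu (cyl n w)) - (birkhoff phi n w - n%:R * p)|.
(* The smallest exponent valid for all configurations at once; $C_n=e^{r_n}$, and [pr_cyl_asymp]
   gives $r_n=o(n)$. *)
pose r n : R := sup (range (dev n)).
have ub n : has_ubound (range (dev n)).
  have [c c0 hc] := pr_cyl_bounded n; have [B B0 hB] := birkhoff_bounded phiu.
  exists (- ln c + n%:R * B + `|n%:R * p|) => _ [w _ <-].
  have /andP[c1 c2] := hc w; rewrite /dev.
  have pc := lt_le_trans c0 c1.
  have : ln c <= ln (pr mu (cyl n w)) by rewrite ler_ln ?posrE.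
  have : ln (pr mu (cyl n w)) <= 0 by exact: ln_le0.
  have := hB n w; have := ler_norm (n%:R * p); have := ler_norm (- (n%:R * p)).
  rewrite normrN !ler_norml => ? ? /andP[? ?] ? ?; apply/andP; split; lra.
have dev_r n w : dev n w <= r n by apply: ub_le_sup => //; exists w.
have r0 n : 0 <= r n by apply: le_trans (dev_r n w0); exact: normr_ge0.
exists p, (fun n => expR (r n)); split; first by move=> n _; exact: expR_gt0.
split.
  apply/cvgrPdist_le => eps eps0; have [n0 h0] := pr_cyl_asymp eps0.
  exists n0.+1 => // n /= hn; rewrite expRK sub0r normrN ger0_norm ?divr_ge0 //.
  rewrite ler_pdivrMr ?ltr0n; last lia.
  rewrite mulrC; apply: ge_sup; first by exists (dev n w0); exists w0.
  by move=> _ [w _ <-]; apply: h0; lia.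
move=> n w n0; have [c c0 /(_ w) /andP[c1 _]] := pr_cyl_bounded n.
have pc := lt_le_trans c0 c1; rewrite -/(pr mu _).
rewrite -{1 2}(lnK (x := pr mu (cyl n w))) ?posrE // -expRN -expRB !ler_expR.
have := dev_r n w; rewrite /dev ler_norml => /andP[? ?].
by apply/andP; split; lra.
Qed.

End Equilibrium.

Theorem theoremA (E : finType) (e0 : E) (R : realType) (phi : Omega e0 -> R) :
  continuous phi ->
  extensible phi ->
  forall mu : probability (OmegaM e0) R,
    equilibrium_state phi mu ->
    (exists gamma : spec_type e0 R, gibbsian_spec gamma /\ is_gibbs_for mu gamma) /\
    weak_bowen_gibbs mu phi.
Proof.
move=> /continuous_ucont phiu phie mu mu_eq; split.
  exists (gibbs_spec phi); split; first exact: gibbs_spec_gibbsian.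
  exact: equilibrium_gibbs.
exact: equilibrium_weak_bowen_gibbs.
Qed.
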